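(* Let $T>0$, $M>0$, $0<\delta\le\tfrac12$, and let $\lambda\colon[0,T]\to\mathbb{R}$ satisfy $\|\lambda\|_{\mathrm{Lip}(1/2)}\le1$ and $|\lambda(t_1)-\lambda(t_2)|\le M|t_1-t_2|^{\frac12+\delta}$ for all $t_1,t_2\in[0,T]$. Then the slit $\gamma=\gamma^\lambda$ is differentiable on $(0,T)$ and $$\gamma'(s)=\frac{i}{\sqrt s}\exp\left\{\int_0^s\left[\frac1{2u}+\frac{2}{\gamma(s-u,s)^2}\right]du\right\}$$ for all $s\in(0,T)$. At $s=T$ the left derivative $\gamma'_-(T)$ exists and is given by the same formula.
   Context: Let $\mathbb{H}=\{z\in\mathbb{C}:\operatorname{Im} z>0\}$. For a continuous $\lambda\colon[0,T]\to\mathbb{R}$ (a driving function), let $g_t(z)$ be the solution of the chordal Loewner equation $\partial_t g_t(z)=\frac{2}{g_t(z)-\lambda(t)}$, $g_0(z)=z$, and let $H_t$ be the set of $z\in\mathbb{H}$ for which the solution is well defined up to time $t$ (i.e. $g_s(z)\ne\lambda(s)$ for $s\in[0,t]$). Then $g_t\colon H_t\to\mathbb{H}$ is conformal. Put $\|\lambda\|_{\mathrm{Lip}(1/2)}=\sup_{t_1\ne t_2\in[0,T]}|\lambda(t_1)-\lambda(t_2)|/|t_1-t_2|^{1/2}$. It is known (Marshall–Rohde, Lind) that if $\|\lambda\|_{\mathrm{Lip}(1/2)}<4$, then $\lambda$ generates a slit $\gamma=\gamma^{\lambda}\colon[0,T]\to\overline{\mathbb{H}}$: a simple curve with $\gamma(0)=\lambda(0)\in\mathbb{R}$,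 $\gamma(t)\in\mathbb{H}$ for $0<t\le T$, and $H_t=\mathbb{H}\setminus\gamma([0,t])$ for all $t$; moreover $\gamma(t)=\lim_{y\downarrow0}g_t^{-1}(\lambda(t)+iy)$. For $0\le s<t\le T$: $\gamma(s,t):=g_s(\gamma(t))-\lambda(s)$. *)

(* Defs.v *)
From Stdlib Require Import Reals ClassicalEpsilon.
From Coquelicot Require Import Coquelicot.
Open Scope R_scope.

(** Functions on a real interval are represented by total functions on [R];
    only their values on that interval are ever used.  The plane is
    [C_R_NormedModule], i.e. [C] as a real normed space. *)

(** The derivative relative to [D] (one-sided at an endpoint of an interval):
    Coquelicot's [is_derive] with [locally x] replaced by its trace on [D]. *)
Definition is_derive_within (D : R -> Prop) (f : R -> C) (x : R) (l : C) : Prop :=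
  filterdiff (K := R_AbsRing) (U := R_NormedModule) (V := C_R_NormedModule)
    f (within D (locally x)) (fun h : R => scal h l).

Definition Cexp (z : C) : C :=
  (exp (Re z) * cos (Im z), exp (Re z) * sin (Im z)).

(** [f] is integrable on (0,s], with a possible singularity at 0, and its
    integral is [I].  Absolute convergence is required, so that for [f]
    continuous on (0,s] this is also the Lebesgue integral. *)
Definition is_int_from_0 (f : R -> C) (s : R) (I : C) : Prop :=
  is_RInt_gen (V := C_R_NormedModule) f (at_right 0) (at_point s) I /\
  ex_RInt_gen (V := R_NormedModule) (fun u => Cmod (f u)) (at_right 0) (at_point s).

Definition lip_half_norm (T : R) (lam : R -> R) : Rbar :=
  Lub_Rbar (fun r => exists t1 t2 : R,
    0 <= t1 <= T /\ 0 <= t2 <= T /\ t1 <> t2 /\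
    r = Rabs (lam t1 - lam t2) / sqrt (Rabs (t1 - t2))).

(** [g] is the trajectory s |-> g_s(z), well defined up to time [t]. *)
Definition loewner_sol (lam : R -> R) (t : R) (z : C) (g : R -> C) : Prop :=
  g 0 = z /\
  forall s : R, 0 <= s <= t ->
    g s <> RtoC (lam s) /\
    is_derive_within (fun u => 0 <= u <= t) g s (2 / (g s - lam s))%C.

(** [z] belongs to H_t. *)
Definition loewner_domain (lam : R -> R) (t : R) (z : C) : Prop :=
  0 < Im z /\ exists g : R -> C, loewner_sol lam t z g.

(** g_t(z); meaningful for [z] in H_t, where the value is unique because the
    solution of the Loewner equation is. *)
Definition loewner_map (lam : R -> R) (t : R) (z : C) : C :=
  epsilon (inhabits (RtoC 0))
    (fun w : C => exists g : R -> C, loewner_sol lam t z g /\ g t = w).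

Definition generates_slit (T : R) (lam : R -> R) (gam : R -> C) : Prop :=
  continuous_on (T := R_UniformSpace) (U := C_UniformSpace)
    (fun t => 0 <= t <= T) gam /\
  (forall s t : R, 0 <= s <= T -> 0 <= t <= T -> gam s = gam t -> s = t) /\
  gam 0 = RtoC (lam 0) /\
  (forall t : R, 0 < t <= T -> 0 < Im (gam t)) /\
  (forall t : R, 0 <= t <= T -> forall z : C,
    loewner_domain lam t z <->
    0 < Im z /\ ~ (exists s : R, 0 <= s <= t /\ gam s = z)).

(** gamma(s,t) = g_s(gamma(t)) - lambda(s). *)
Definition slit2 (lam : R -> R) (gam : R -> C) (s t : R) : C :=
  (loewner_map lam s (gam t) - lam s)%C.

(** [v] is (i / sqrt s) exp {int_0^s [1/(2u) + 2/gamma(s-u,s)^2] du}, the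
    integral being convergent. *)
Definition slit_velocity (lam : R -> R) (gam : R -> C) (s : R) (v : C) : Prop :=
  exists I : C,
    is_int_from_0
      (fun u : R => (1 / (2 * u) + 2 / (slit2 lam gam (s - u) s) ^ 2)%C) s I /\
    v = (Ci / sqrt s * Cexp I)%C.

(* Main.v *)
Require Import Defs.
From Stdlib Require Import Reals Lra ClassicalEpsilon Classical.
From Coquelicot Require Import Coquelicot.
Open Scope R_scope.

(** Fix a time [t] and follow the tip of the slit: let [Z r = g_r(gam t)] and
    [X r = Z r - lam r] for [0 <= r < t].  Since [gam t] survives every time before
    [t] but not [t] itself, [Im Z] tends to 0 at [t] ([slit_absorbed]).

    For the zero driving function the slit is vertical and [X r = 2 i sqrt (t - r)].
    As [lam] is better than Hoelder-1/2, it is negligible at small scales, and [X]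
    is close to that model: [|X r - 2 i sqrt (t - r)| <= 3 M (t - r)^(1/2 + delta)]
    ([absorbed_near_straight]).  The proof compares squares and needs to know
    beforehand that [X] is at least of order [sqrt (t - r)].  This is where the
    Lip(1/2) norm is used ([absorbed_bounds]): in reversed time [Re Z] is an average
    of [lam], which makes [Re X] small, and then the equation for [Im Z] forces
    [(Im Z)^2 >= 2 (t - r)].

    Now take two times [s] and [t].  The gap [Q] of the two trajectories solves the
    linear equation [Q' = - 2 Q / (Xs Xt)], and the gap [P] of the two straight
    trajectories solves the analogous one.  Hence [Q / P] ([ratio]) has logarithmic
    derivative [- kern], where [kern] is the difference of the two rates, and
    [kern = O(u^(delta - 1))] at distance [u] from the absorption times
    ([kern_le]), which is integrable.  At a time [h] before absorption, with
    [|t - s|] much smaller than [h] and [h] tending to 0, the ratio is close to 1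
    ([ratio_near_1]).  Going back to flow time 0 from there, [kern] for [s] and [t]
    can be replaced by [kern] for [s] and [s] ([kern_diff_le]); so the ratio at
    time 0 tends to the exponential of the integral of the latter
    ([ratio_0_near_exp]), whose integrand at time [s - u] is
    [1 / (2 u) + 2 / (X (s - u))^2].  Finally
    [gam t - gam s = ratio * (2 i sqrt t - 2 i sqrt s)] at time 0, and dividing by
    [t - s] gives the formula. *)

(** * Monotonicity and limits of real functions *)

Lemma le_of_derive_nonneg (f df : R -> R) (a b : R) :
  a <= b ->
  (forall x, a < x < b -> is_derive f x (df x)) ->
  (forall x, a <= x <= b -> continuous f x) ->
  (forall x, a < x < b -> 0 <= df x) ->
  f a <= f b.
Proof.
  intros Hab Hd Hc Hp.
  destruct (MVT_gen f a b (fun x => Rmax 0 (df x))) as [c [_ Hc2]].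
  - rewrite Rmin_left, Rmax_right by lra. intros x Hx.
    rewrite Rmax_right by (apply Hp; lra). apply Hd; lra.
  - rewrite Rmin_left, Rmax_right by lra. intros x Hx.
    apply continuity_pt_filterlim, Hc; lra.
  - assert (0 <= Rmax 0 (df c)) by apply Rmax_l. nra.
Qed.

Lemma at_left_interval (a b : R) : a < b -> at_left b (fun x => a < x < b).
Proof.
  intros H. exists (mkposreal (b - a) (proj2 (Rlt_0_minus _ _) H)).
  intros x Hx Hxb. apply Rabs_lt_between' in Hx. simpl in Hx. lra.
Qed.

Lemma at_left_imp (t a : R) (P : R -> Prop) :
  a < t -> (forall r, a < r < t -> P r) -> at_left t P.
Proof.
  intros H HP. generalize (at_left_interval a t H). now apply filter_imp.
Qed.

Lemma derive_continuous (f : R -> R) (x l : R) :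
  is_derive f x l -> continuous f x.
Proof. intros H. apply (ex_derive_continuous f x). now exists l. Qed.

Lemma le_limit_of_derive_nonneg (f df : R -> R) (a b l : R) :
  a < b ->
  (forall x, a <= x < b -> is_derive f x (df x)) ->
  (forall x, a <= x < b -> 0 <= df x) ->
  filterlim f (at_left b) (locally l) ->
  f a <= l.
Proof.
  intros Hab Hd Hp Hl.
  apply (filterlim_le (F := at_left b) (fun _ => f a) f (Finite (f a)) (Finite l)).
  - generalize (at_left_interval a b Hab). apply filter_imp. intros x Hx.
    apply (le_of_derive_nonneg f df); try lra; intros y Hy.
    + apply Hd; lra.
    + apply (derive_continuous f y (df y)), Hd; lra.
    + apply Hp; lra.
  - apply filterlim_const.
  - exact Hl.
Qed.

Lemma lim_plus {T} (F : (T -> Prop) -> Prop) {FF : Filter F} (f g : T -> R) (a b : R) :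
  filterlim f F (locally a) -> filterlim g F (locally b) ->
  filterlim (fun r => f r + g r) F (locally (a + b)).
Proof.
  intros H1 H2. eapply filterlim_comp_2; [exact H1 | exact H2 |].
  exact (filterlim_plus (V := R_NormedModule) a b).
Qed.

Lemma lim_mult {T} (F : (T -> Prop) -> Prop) {FF : Filter F} (f g : T -> R) (a b : R) :
  filterlim f F (locally a) -> filterlim g F (locally b) ->
  filterlim (fun r => f r * g r) F (locally (a * b)).
Proof.
  intros H1 H2. eapply filterlim_comp_2; [exact H1 | exact H2 |].
  exact (filterlim_mult (K := R_AbsRing) a b).
Qed.

Lemma lim_opp {T} (F : (T -> Prop) -> Prop) (f : T -> R) (a : R) :
  filterlim f F (locally a) -> filterlim (fun r => - f r) F (locally (- a)).
Proof.
  intros H1. eapply filterlim_comp; [exact H1 |].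
  exact (filterlim_opp (V := R_NormedModule) a).
Qed.

Lemma lim_minus {T} (F : (T -> Prop) -> Prop) {FF : Filter F} (f g : T -> R) (a b : R) :
  filterlim f F (locally a) -> filterlim g F (locally b) ->
  filterlim (fun r => f r - g r) F (locally (a - b)).
Proof. intros H1 H2. apply lim_plus; auto. now apply lim_opp. Qed.

Lemma lim_eq {T} (F : (T -> Prop) -> Prop) (f : T -> R) (a b : R) :
  filterlim f F (locally a) -> a = b -> filterlim f F (locally b).
Proof. now intros H <-. Qed.

Lemma lim_zero_of_sq {T} (F : (T -> Prop) -> Prop) {FF : Filter F} (f g : T -> R) :
  F (fun r => f r * f r <= g r) -> filterlim g F (locally 0) ->
  filterlim f F (locally 0).
Proof.
  intros H1 H2. apply filterlim_locally. intros eps.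
  assert (He : 0 < eps * eps) by (apply Rmult_lt_0_compat; apply cond_pos).
  generalize (filter_and _ _ H1 (proj1 (filterlim_locally g 0) H2 (mkposreal _ He))).
  apply filter_imp. intros r [Ha Hb].
  unfold ball in *; simpl in *; unfold AbsRing_ball, abs, minus, plus, opp in *; simpl in *.
  apply Rabs_def2 in Hb. pose proof (cond_pos eps).
  apply Rabs_def1; nra.
Qed.

Lemma lim_at_left_cont (f : R -> R) (t l : R) :
  continuous f t -> f t = l -> filterlim f (at_left t) (locally l).
Proof.
  intros H <-. eapply filterlim_filter_le_1; [|exact H].
  intros P [e He]. exists e. intros; now apply He.
Qed.

Lemma derive_plus (f g : R -> R) x a b :
  is_derive f x a -> is_derive g x b -> is_derive (fun r => f r + g r) x (a + b).
Proof. intros H1 H2. exact (is_derive_plus f g x a b H1 H2). Qed.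

Lemma derive_minus (f g : R -> R) x a b :
  is_derive f x a -> is_derive g x b -> is_derive (fun r => f r - g r) x (a - b).
Proof. intros H1 H2. exact (is_derive_minus f g x a b H1 H2). Qed.

Lemma derive_mult (f g : R -> R) x a b :
  is_derive f x a -> is_derive g x b ->
  is_derive (fun r => f r * g r) x (a * g x + f x * b).
Proof. intros H1 H2. exact (is_derive_mult f g x a b H1 H2 Rmult_comm). Qed.

Lemma derive_const (c x : R) : is_derive (fun _ : R => c) x 0.
Proof. exact (is_derive_const c x). Qed.

Lemma derive_id (x : R) : is_derive (fun r : R => r) x 1.
Proof. exact (is_derive_id x). Qed.

Lemma derive_comp (f g : R -> R) x a b :
  is_derive f (g x) a -> is_derive g x b -> is_derive (fun r => f (g r)) x (b * a).
Proof. intros H1 H2. exact (is_derive_comp f g x a b H1 H2). Qed.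

Lemma derive_eq (f : R -> R) (x a b : R) : is_derive f x a -> a = b -> is_derive f x b.
Proof. now intros H <-. Qed.

(** * Complex functions of a real variable *)

(** Componentwise, so that complex derivatives reduce to real ones. *)
Definition Cderiv (f : R -> C) (x : R) (l : C) : Prop :=
  is_derive (fun r => Re (f r)) x (Re l) /\ is_derive (fun r => Im (f r)) x (Im l).

Definition Ccont (f : R -> C) (x : R) : Prop :=
  continuous (fun r => Re (f r)) x /\ continuous (fun r => Im (f r)) x.

Lemma norm2_pos (z : C) : z <> 0 -> 0 < Re z ^ 2 + Im z ^ 2.
Proof.
  intros Hz. rewrite <- Cmod2_alt. apply pow_lt. now apply Cmod_gt_0.
Qed.

Lemma Cmod_sq (z : C) : Cmod z * Cmod z = Re z * Re z + Im z * Im z.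
Proof. pose proof (Cmod2_alt z). simpl in H. lra. Qed.

Lemma Cmod_Ci : Cmod Ci = 1.
Proof.
  unfold Cmod, Ci; simpl.
  replace (0 * (0 * 1) + 1 * (1 * 1)) with 1 by ring. apply sqrt_1.
Qed.

Lemma Cmod_Im_ge (z : C) : Rabs (Im z) <= Cmod z.
Proof.
  apply Rsqr_incr_0_var; [|apply Cmod_ge_0].
  unfold Rsqr. rewrite Cmod_sq. rewrite <- Rabs_mult, Rabs_pos_eq by apply Rle_0_sqr.
  pose proof (Rle_0_sqr (Re z)). unfold Rsqr in *. lra.
Qed.

Lemma Cmod_le_sum z : Cmod z <= Rabs (Re z) + Rabs (Im z).
Proof.
  replace z with (RtoC (Re z) + Ci * RtoC (Im z))%C at 1.
  - eapply Rle_trans; [apply Cmod_triangle|]. rewrite Cmod_mult, !Cmod_R.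
    rewrite Cmod_Ci. lra.
  - destruct z. apply injective_projections; unfold Re, Im; simpl; ring.
Qed.

Lemma inner_le_Cmod (z w : C) : Re z * Re w + Im z * Im w <= Cmod z * Cmod w.
Proof.
  pose proof (Cmod_sq z); pose proof (Cmod_sq w).
  pose proof (Cmod_ge_0 z); pose proof (Cmod_ge_0 w).
  apply Rsqr_incr_0_var; [|now apply Rmult_le_pos].
  unfold Rsqr.
  replace (Cmod z * Cmod w * (Cmod z * Cmod w))
    with ((Cmod z * Cmod z) * (Cmod w * Cmod w)) by ring.
  rewrite H, H0. pose proof (pow2_ge_0 (Re z * Im w - Im z * Re w)). nra.
Qed.

Lemma Rabs_inner_le_Cmod (z w : C) : Rabs (Re z * Re w + Im z * Im w) <= Cmod z * Cmod w.
Proof.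
  apply Rabs_le. split; [|apply inner_le_Cmod].
  pose proof (inner_le_Cmod (- z)%C w) as Hi. rewrite Cmod_opp in Hi.
  unfold Re, Im in *; simpl in *; lra.
Qed.

Lemma Cderiv_eq (f : R -> C) x a b : Cderiv f x a -> a = b -> Cderiv f x b.
Proof. now intros H <-. Qed.

Lemma Cderiv_cont f x l : Cderiv f x l -> Ccont f x.
Proof. intros [H1 H2]. split; eapply derive_continuous; eassumption. Qed.

Lemma Cderiv_const c x : Cderiv (fun _ => c) x 0.
Proof. split; apply derive_const. Qed.

Lemma Cderiv_plus f g x a b :
  Cderiv f x a -> Cderiv g x b -> Cderiv (fun r => f r + g r)%C x (a + b)%C.
Proof. intros [H1 H2] [H3 H4]. split; simpl; now apply derive_plus. Qed.

Lemma Cderiv_minus f g x a b :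
  Cderiv f x a -> Cderiv g x b -> Cderiv (fun r => f r - g r)%C x (a - b)%C.
Proof.
  intros [H1 H2] [H3 H4].
  split; simpl; (eapply derive_eq; [eapply derive_minus; eassumption | reflexivity]).
Qed.

Lemma Cderiv_mult f g x a b :
  Cderiv f x a -> Cderiv g x b ->
  Cderiv (fun r => f r * g r)%C x (a * g x + f x * b)%C.
Proof.
  intros [H1 H2] [H3 H4]. split; simpl.
  - eapply derive_eq.
    apply derive_minus; apply derive_mult; eassumption. unfold Re, Im; simpl; ring.
  - eapply derive_eq.
    apply derive_plus; apply derive_mult; eassumption. unfold Re, Im; simpl; ring.
Qed.

Lemma Cderiv_inv f x a :
  Cderiv f x a -> f x <> 0 -> Cderiv (fun r => / f r)%C x (- a / (f x * f x))%C.
Proof.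
  intros [H1 H2] Hz. pose proof (norm2_pos _ Hz) as Hn.
  assert (Hd : is_derive (fun r => Re (f r) ^ 2 + Im (f r) ^ 2) x
     (2 * Re (f x) * Re a + 2 * Im (f x) * Im a)).
  { eapply derive_eq.
    apply (derive_plus (fun r => Re (f r) ^ 2) (fun r => Im (f r) ^ 2)).
    apply (is_derive_pow (fun r => Re (f r)) 2 x _ H1).
    apply (is_derive_pow (fun r => Im (f r)) 2 x _ H2).
    simpl; ring. }
  destruct (f x) as [u v] eqn:E, a as [p q]. simpl in *.
  assert (0 < u*u+v*v) by nra.
  assert (Hne : (u * u - v * v) * (u * u - v * v) + (u * v + v * u) * (u * v + v * u) <> 0) by nra.
  split; simpl.
  - eapply derive_eq.
    apply (is_derive_div (fun r => Re (f r)) (fun r => Re (f r) ^ 2 + Im (f r) ^ 2)); try eassumption.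
    rewrite E; simpl; lra. rewrite E; simpl. field. repeat split; nra.
  - eapply derive_eq.
    apply (is_derive_div (fun r => - Im (f r)) (fun r => Re (f r) ^ 2 + Im (f r) ^ 2)); try eassumption.
    eapply (is_derive_opp (fun r => Im (f r)) x _ H2).
    rewrite E; simpl; lra. rewrite E; simpl. unfold opp; simpl. field. repeat split; nra.
Qed.

Lemma Cderiv_exp f x a :
  Cderiv f x a -> Cderiv (fun r => Cexp (f r)) x (a * Cexp (f x))%C.
Proof.
  intros [H1 H2]. split; simpl.
  - eapply derive_eq.
    apply derive_mult. apply (derive_comp exp). apply is_derive_exp. exact H1.
    apply (derive_comp cos). apply is_derive_cos. exact H2. unfold Re, Im; simpl; ring.
  - eapply derive_eq.
    apply derive_mult. apply (derive_comp exp). apply is_derive_exp. exact H1.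
    apply (derive_comp sin). apply is_derive_sin. exact H2. unfold Re, Im; simpl; ring.
Qed.

Lemma Ccont_eps f x :
  Ccont f x <-> forall eps, 0 < eps -> exists d, 0 < d /\ forall y, Rabs (y - x) < d ->
     Cmod (f y - f x) < eps.
Proof.
  split.
  - intros [H1 H2] eps He. assert (He2 : 0 < eps / 2) by lra.
    destruct (proj1 (filterlim_locally _ _) H1 (mkposreal _ He2)) as [d1 Hd1].
    destruct (proj1 (filterlim_locally _ _) H2 (mkposreal _ He2)) as [d2 Hd2].
    exists (Rmin d1 d2). split; [apply Rmin_pos; apply cond_pos|]. intros y Hy.
    assert (A1 := Hd1 y (Rlt_le_trans _ _ _ Hy (Rmin_l _ _))).
    assert (A2 := Hd2 y (Rlt_le_trans _ _ _ Hy (Rmin_r _ _))).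
    change (Rabs (Re (f y) - Re (f x)) < eps / 2) in A1.
    change (Rabs (Im (f y) - Im (f x)) < eps / 2) in A2.
    eapply Rle_lt_trans; [apply Cmod_le_sum|].
    change (Re (f y - f x)%C) with (Re (f y) - Re (f x)).
    change (Im (f y - f x)%C) with (Im (f y) - Im (f x)). lra.
  - intros H. split; apply filterlim_locally; intros eps;
      destruct (H eps (cond_pos eps)) as [d [Hd0 Hd]]; exists (mkposreal d Hd0);
      intros y Hy; (eapply Rle_lt_trans; [|apply (Hd y Hy)]).
    + apply (re_le_Cmod (f y - f x)%C).
    + apply (Cmod_Im_ge (f y - f x)%C).
Qed.

Lemma Ccont_ext_loc f g x d :
  0 < d -> (forall y, Rabs (y - x) < d -> f y = g y) -> Ccont f x -> Ccont g x.
Proof.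
  intros Hd H [H1 H2].
  assert (Hx : f x = g x) by (apply H; unfold Rminus; rewrite Rplus_opp_r, Rabs_R0; auto).
  split; [apply (continuous_ext_loc _ (fun r => Re (f r))); [|exact H1]
         | apply (continuous_ext_loc _ (fun r => Im (f r))); [|exact H2]];
    exists (mkposreal d Hd); intros y Hy; simpl; rewrite (H y Hy); reflexivity.
Qed.

Lemma Ccont_minus f g x : Ccont f x -> Ccont g x -> Ccont (fun r => f r - g r)%C x.
Proof.
  intros [H1 H2] [H3 H4].
  split; apply (continuous_minus (V := R_NormedModule)); assumption.
Qed.

Lemma Ccont_mult f g x : Ccont f x -> Ccont g x -> Ccont (fun r => f r * g r)%C x.
Proof.
  intros [H1 H2] [H3 H4]. split.
  - apply (continuous_minus (V := R_NormedModule));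
      apply (continuous_mult (K := R_AbsRing)); assumption.
  - apply (continuous_plus (V := R_NormedModule));
      apply (continuous_mult (K := R_AbsRing)); assumption.
Qed.

Lemma Ccont_inv f x : Ccont f x -> f x <> 0 -> Ccont (fun r => / f r)%C x.
Proof.
  intros [H1 H2] Hne. pose proof (norm2_pos _ Hne) as Hp. simpl in Hp.
  assert (Hn : continuous (fun r => / (Re (f r) * (Re (f r) * 1) + Im (f r) * (Im (f r) * 1))) x).
  { apply continuous_Rinv_comp; [|lra].
    apply (continuous_plus (V := R_NormedModule)); apply (continuous_mult (K := R_AbsRing)); auto;
      apply (continuous_mult (K := R_AbsRing)); auto; apply continuous_const. }
  split; apply (continuous_mult (K := R_AbsRing)); auto.
  apply (continuous_opp (V := R_NormedModule)); auto.
Qed.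

Lemma Ccont_RtoC (L : R -> R) x : continuous L x -> Ccont (fun r => RtoC (L r)) x.
Proof. intros H. split; simpl; [exact H | apply continuous_const]. Qed.

Lemma Ccont_Cmod f x : Ccont f x -> continuous (fun r => Cmod (f r)) x.
Proof.
  intros H. apply filterlim_locally. intros eps.
  destruct (proj1 (Ccont_eps f x) H eps (cond_pos eps)) as [d [Hd0 Hd]].
  exists (mkposreal d Hd0). intros y Hy. eapply Rle_lt_trans; [|apply (Hd y Hy)].
  change (Rabs (Cmod (f y) - Cmod (f x)) <= Cmod (f y - f x)).
  assert (Cmod (f y) <= Cmod (f y - f x) + Cmod (f x)).
  { eapply Rle_trans; [|apply Cmod_triangle]. right; f_equal; ring. }
  assert (Cmod (f x) <= Cmod (- (f y - f x)) + Cmod (f y)).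
  { eapply Rle_trans; [|apply Cmod_triangle]. right; f_equal; ring. }
  rewrite Cmod_opp in H1. apply Rabs_le. lra.
Qed.

Lemma Ccont_Cexp f x : Ccont f x -> Ccont (fun r => Cexp (f r)) x.
Proof.
  intros [H1 H2].
  assert (He : continuous (fun r => exp (Re (f r))) x).
  { apply (continuous_comp (fun r => Re (f r)) exp); auto.
    eapply derive_continuous. apply is_derive_exp. }
  split; apply (continuous_mult (K := R_AbsRing)); auto.
  - apply (continuous_comp (fun r => Im (f r)) cos); auto.
    eapply derive_continuous. apply is_derive_cos.
  - apply (continuous_comp (fun r => Im (f r)) sin); auto.
    eapply derive_continuous. apply is_derive_sin.
Qed.

(** Trajectories and partial integrals are known up to, but not at, a singular
    time; this is how their limit there is made usable. *)
Lemma Ccont_glue_left (f : R -> C) (l : C) (s : R) :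
  filterlim (fun r => Re (f r)) (at_left s) (locally (Re l)) ->
  filterlim (fun r => Im (f r)) (at_left s) (locally (Im l)) ->
  Ccont (fun r => if Rlt_dec r s then f r else l) s.
Proof.
  intros H1 H2.
  assert (Hone : forall p : C -> R, filterlim (fun r => p (f r)) (at_left s) (locally (p l)) ->
     continuous (fun r => p (if Rlt_dec r s then f r else l)) s).
  { intros p Hp. unfold continuous. destruct (Rlt_dec s s) as [Hs | _]; [lra|].
    apply filterlim_locally. intros e.
    destruct (proj1 (filterlim_locally _ _) Hp e) as [d Hd].
    exists d. intros y Hy. destruct (Rlt_dec y s).
    - now apply Hd.
    - apply ball_center. }
  split; apply Hone; assumption.
Qed.

Lemma exp_le x y : x <= y -> exp x <= exp y.
Proof. intros [H| ->]; [left; now apply exp_increasing | lra]. Qed.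

Lemma Cmod_Cexp z : Cmod (Cexp z) = exp (Re z).
Proof.
  apply Rsqr_inj; [apply Cmod_ge_0 | left; apply exp_pos |].
  destruct z as [a b]. unfold Rsqr. rewrite Cmod_sq. unfold Cexp, Re, Im; simpl.
  pose proof (sin2_cos2 b) as H. unfold Rsqr in H.
  transitivity (exp a * exp a * (sin b * sin b + cos b * cos b)); [ring | rewrite H; ring].
Qed.

Lemma Cmod_Cexp_le z b : Cmod z <= b -> Cmod (Cexp z) <= exp b.
Proof.
  intros H. rewrite Cmod_Cexp. apply exp_le.
  eapply Rle_trans; [|exact H]. eapply Rle_trans; [apply Rle_abs | apply re_le_Cmod].
Qed.

Lemma Cexp_0 : Cexp 0 = 1.
Proof.
  unfold Cexp. simpl. rewrite exp_0, cos_0, sin_0. apply injective_projections; simpl; ring.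
Qed.

(** * Differential inequalities *)

(** A vector-valued mean value inequality: project on the direction of the
    increment. *)
Lemma Cmod_increment_le (f df : R -> C) (g dg : R -> R) (a b : R) :
  a <= b ->
  (forall x, a < x < b -> Cderiv f x (df x)) ->
  (forall x, a <= x <= b -> Ccont f x) ->
  (forall x, a < x < b -> is_derive g x (dg x)) ->
  (forall x, a <= x <= b -> continuous g x) ->
  (forall x, a < x < b -> Cmod (df x) <= dg x) ->
  Cmod (f b - f a) <= g b - g a.
Proof.
  intros Hab Hf Hfc Hg Hgc Hle.
  set (w := (f b - f a)%C).
  assert (Hmono : g a <= g b).
  { apply (le_of_derive_nonneg g dg); auto. intros x Hx.
    generalize (Hle x Hx) (Cmod_ge_0 (df x)); lra. }
  destruct (Req_dec (Cmod w) 0) as [H0 | H0]; [lra|].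
  pose proof (Cmod_ge_0 w) as Hw.
  assert (Hphi : g a * Cmod w - (Re (f a) * Re w + Im (f a) * Im w)
     <= g b * Cmod w - (Re (f b) * Re w + Im (f b) * Im w)).
  { apply (le_of_derive_nonneg
      (fun r => g r * Cmod w - (Re (f r) * Re w + Im (f r) * Im w))
      (fun r => dg r * Cmod w - (Re (df r) * Re w + Im (df r) * Im w))); auto.
    - intros x Hx. destruct (Hf x Hx) as [H1 H2]. eapply derive_eq.
      apply derive_minus. apply derive_mult. apply Hg; auto. apply derive_const.
      apply derive_plus; apply derive_mult; try eassumption; apply derive_const.
      cbv beta; ring.
    - intros x Hx. destruct (Hfc x Hx) as [H1 H2].
      apply (continuous_minus (V := R_NormedModule)).
      apply (continuous_mult (K := R_AbsRing)); [now apply Hgc | apply continuous_const].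
      apply (continuous_plus (V := R_NormedModule));
      apply (continuous_mult (K := R_AbsRing)); auto; apply continuous_const.
    - intros x Hx. pose proof (inner_le_Cmod (df x) w). pose proof (Hle x Hx).
      nra. }
  assert (Hww := Cmod_sq w).
  assert (Hr : Re w = Re (f b) - Re (f a)) by reflexivity.
  assert (Hi : Im w = Im (f b) - Im (f a)) by reflexivity.
  assert (Cmod w * Cmod w <= (g b - g a) * Cmod w) by (rewrite Hww; nra).
  nra.
Qed.

(** Trajectories exist only before their absorption time, so here the end point
    [b] enters through limits. *)
Lemma Cmod_le_to_zero (f df : R -> C) (g dg : R -> R) (a b : R) :
  a < b ->
  (forall x, a <= x < b -> Cderiv f x (df x)) ->
  (forall x, a <= x < b -> is_derive g x (dg x)) ->
  (forall x, a <= x < b -> Cmod (df x) <= dg x) ->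
  filterlim (fun r => Re (f r)) (at_left b) (locally 0) ->
  filterlim (fun r => Im (f r)) (at_left b) (locally 0) ->
  filterlim g (at_left b) (locally 0) ->
  Cmod (f a) <= - g a.
Proof.
  intros Hab Hf Hg Hle Hl1 Hl2 Hlg.
  set (w := (- f a)%C).
  assert (Hw : Cmod w = Cmod (f a)) by apply Cmod_opp.
  assert (Hmono : g a <= 0).
  { apply (le_limit_of_derive_nonneg g dg a b); auto. intros x Hx.
    generalize (Hle x Hx) (Cmod_ge_0 (df x)); lra. }
  pose proof (Cmod_ge_0 w).
  destruct (Req_dec (Cmod w) 0) as [H0 | H0]; [lra|].
  assert (Hphi : g a * Cmod w - (Re (f a) * Re w + Im (f a) * Im w) <= 0).
  { apply (le_limit_of_derive_nonneg
      (fun r => g r * Cmod w - (Re (f r) * Re w + Im (f r) * Im w))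
      (fun r => dg r * Cmod w - (Re (df r) * Re w + Im (df r) * Im w)) a b); auto.
    - intros x Hx. destruct (Hf x Hx) as [H1 H2]. eapply derive_eq.
      apply derive_minus. apply derive_mult. apply Hg; auto. apply derive_const.
      apply derive_plus; apply derive_mult; try eassumption; apply derive_const.
      cbv beta; ring.
    - intros x Hx. pose proof (inner_le_Cmod (df x) w). pose proof (Hle x Hx).
      nra.
    - apply lim_eq with (0 * Cmod w - (0 * Re w + 0 * Im w)); [|ring].
      apply (lim_minus (at_left b)).
      + apply (lim_mult (at_left b)); [exact Hlg | apply filterlim_const].
      + apply (lim_plus (at_left b)); apply (lim_mult (at_left b)); auto; apply filterlim_const. }
  assert (Hww := Cmod_sq w).
  assert (Hr : Re w = - Re (f a)) by reflexivity.
  assert (Hi : Im w = - Im (f a)) by reflexivity.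
  assert (Cmod w * Cmod w <= - g a * Cmod w) by (rewrite Hww; nra).
  nra.
Qed.

(** The rate is given through a primitive [g], because in [ratio_growth_le] it is
    a negative power of the distance to a singular time. *)
Lemma gronwall (f df g dg : R -> R) (a b : R) :
  a <= b ->
  (forall x, a < x < b -> is_derive f x (df x)) ->
  (forall x, a <= x <= b -> continuous f x) ->
  (forall x, a < x < b -> is_derive g x (dg x)) ->
  (forall x, a <= x <= b -> continuous g x) ->
  (forall x, a < x < b -> Rabs (df x) <= dg x * f x) ->
  f b <= f a * exp (g b - g a) /\ f a <= f b * exp (g b - g a).
Proof.
  intros Hab Hf Hfc Hg Hgc Hle.
  assert (Hexp : forall s x, is_derive g x (dg x) ->
     is_derive (fun r => exp (s * g r)) x (s * dg x * exp (s * g x))).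
  { intros s x H. eapply derive_eq. apply (derive_comp exp). apply is_derive_exp.
    apply derive_mult. apply derive_const. exact H. cbv beta; ring. }
  assert (Hcexp : forall s x, continuous g x -> continuous (fun r => exp (s * g r)) x).
  { intros s x H. apply (continuous_comp (fun r => s * g r) exp).
    apply (continuous_mult (K := R_AbsRing) (fun _ => s)); auto. apply continuous_const.
    apply (ex_derive_continuous exp). exists (exp (s * g x)). apply is_derive_exp. }
  split.
  - assert (H : 0 - f a * exp (-1 * g a) <= 0 - f b * exp (-1 * g b)).
    { apply (le_of_derive_nonneg (fun r => 0 - f r * exp (-1 * g r))
       (fun r => 0 - (df r * exp (-1 * g r) + f r * (-1 * dg r * exp (-1 * g r))))); auto.
      - intros x Hx. eapply derive_eq.
        apply derive_minus; [apply derive_const|].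
        apply derive_mult; [apply Hf | apply Hexp, Hg]; auto. reflexivity.
      - intros x Hx. apply (continuous_minus (V := R_NormedModule)); [apply continuous_const|].
        apply (continuous_mult (K := R_AbsRing)); auto.
      - intros x Hx. pose proof (Hle x Hx) as H. apply Rabs_le_between in H.
        pose proof (exp_pos (-1 * g x)). nra. }
    unfold Rminus. rewrite Rplus_comm, exp_plus, <- Rmult_assoc.
    replace (- g a) with (-1 * g a) by ring.
    apply Rmult_le_reg_r with (exp (-1 * g b)). apply exp_pos.
    rewrite (Rmult_assoc _ (exp (g b))), <- exp_plus.
    replace (g b + -1 * g b) with 0 by ring. rewrite exp_0. lra.
  - assert (H : f a * exp (1 * g a) <= f b * exp (1 * g b)).
    { apply (le_of_derive_nonneg (fun r => f r * exp (1 * g r))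
       (fun r => df r * exp (1 * g r) + f r * (1 * dg r * exp (1 * g r)))); auto.
      - intros x Hx. eapply derive_eq.
        apply derive_mult; [apply Hf | apply Hexp, Hg]; auto. reflexivity.
      - intros x Hx. apply (continuous_mult (K := R_AbsRing)); auto.
      - intros x Hx. pose proof (Hle x Hx) as H. apply Rabs_le_between in H.
        pose proof (exp_pos (1 * g x)). nra. }
    unfold Rminus. rewrite exp_plus, <- Rmult_assoc.
    apply Rmult_le_reg_r with (exp (1 * g a)). apply exp_pos.
    rewrite (Rmult_assoc _ (exp (- g a))), <- exp_plus.
    replace (- g a + 1 * g a) with 0 by ring. rewrite exp_0, Rmult_1_r, <- (Rmult_1_l (g b)). exact H.
Qed.

(** * Real powers *)

Lemma Rpower_pos x p : 0 < Rpower x p.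
Proof. apply exp_pos. Qed.

Lemma Rpower_le_base x y p : 0 < x <= y -> 0 <= p -> Rpower x p <= Rpower y p.
Proof. intros H Hp. apply Rle_Rpower_l; lra. Qed.

Lemma Rpower_div_sqrt_decr u v delta :
  0 < u <= v -> delta <= 1 / 2 ->
  Rpower v delta / sqrt v <= Rpower u delta / sqrt u.
Proof.
  intros Huv Hd.
  assert (E : forall x, 0 < x -> Rpower x delta / sqrt x = Rpower x (delta - / 2)).
  { intros x Hx. unfold Rminus. rewrite Rpower_plus, Rpower_Ropp, Rpower_sqrt by auto. reflexivity. }
  rewrite !E by lra. unfold Rpower.
  assert (ln u <= ln v) by (apply ln_le; lra).
  destruct (Req_dec ((delta - / 2) * ln v) ((delta - / 2) * ln u)) as [-> | Hne]; [lra|].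
  left. apply exp_increasing. nra.
Qed.

Lemma derive_Rpower_rev t p r :
  r < t -> is_derive (fun r => Rpower (t - r) p) r (- (p * (Rpower (t - r) p * / (t - r)))).
Proof.
  intros H. unfold Rpower. eapply derive_eq.
  - apply (derive_comp exp); [apply is_derive_exp|].
    apply derive_mult; [apply derive_const|].
    apply (derive_comp ln); [apply is_derive_ln; lra|].
    apply derive_minus; [apply derive_const | apply derive_id].
  - cbv beta. field. lra.
Qed.

Lemma lim_Rpower_0 p : 0 < p -> filterlim (fun u => Rpower u p) (at_right 0) (locally 0).
Proof.
  intros Hp. apply filterlim_locally. intros eps.
  exists (mkposreal (Rpower eps (/ p)) (Rpower_pos _ _)).
  intros u Hu Hu0. apply Rabs_lt_between' in Hu. simpl in Hu.
  apply Rabs_lt_between'. split.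
  - pose proof (Rpower_pos u p). pose proof (cond_pos eps). lra.
  - replace (0 + eps) with (Rpower (Rpower eps (/ p)) p).
    apply Rlt_Rpower_l; lra.
    rewrite Rpower_mult, Rinv_l by lra. rewrite Rpower_1 by apply cond_pos. ring.
Qed.

Lemma small_Rpower p eta : 0 < p -> 0 < eta ->
  exists d, 0 < d /\ forall x, 0 < x < d -> Rpower x p < eta.
Proof.
  intros Hp He.
  destruct (proj1 (filterlim_locally _ _) (lim_Rpower_0 p Hp) (mkposreal eta He)) as [d Hd].
  exists d. split; [apply cond_pos|]. intros x Hx.
  assert (Hb : ball (0 : R) d x) by (change (Rabs (x - 0) < d); rewrite Rabs_pos_eq; lra).
  specialize (Hd x Hb (proj1 Hx)). change (Rabs (Rpower x p - 0) < eta) in Hd.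
  apply Rabs_def2 in Hd. lra.
Qed.

Lemma at_left_rev t : filterlim (fun r => t - r) (at_left t) (at_right 0).
Proof.
  intros P [e He]. exists e. intros r Hr Hrt. apply He; [|lra].
  apply Rabs_lt_between' in Hr. apply Rabs_lt_between'. lra.
Qed.

(** * Trajectories near their absorption time *)

Definition sqrt_lipschitz (L : R -> R) : Prop :=
  forall r r', Rabs (L r - L r') <= sqrt (Rabs (r - r')).

(** The exponent [1/2 + delta] is split so that square roots cancel algebraically;
    [r <> r'] is required because [Rpower 0 _ = 1]. *)
Definition holder (M delta : R) (L : R -> R) : Prop :=
  forall r r', r <> r' ->
    Rabs (L r - L r') <= M * (sqrt (Rabs (r - r')) * Rpower (Rabs (r - r')) delta).

Lemma sqrt_lipschitz_continuous L x : sqrt_lipschitz L -> continuous L x.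
Proof.
  intros HL. apply filterlim_locally. intros eps. pose proof (cond_pos eps) as He.
  assert (Hee : 0 < eps * eps) by now apply Rmult_lt_0_compat.
  exists (mkposreal _ Hee). intros y Hy.
  change (Rabs (y - x) < eps * eps) in Hy. change (Rabs (L y - L x) < eps).
  eapply Rle_lt_trans; [apply HL|].
  rewrite <- (sqrt_Rsqr eps) by lra. apply sqrt_lt_1_alt. unfold Rsqr. split; [apply Rabs_pos | exact Hy].
Qed.

(** [Z] is continued to negative times, where no equation is required, so that
    continuity at time 0 is two-sided. *)
Record absorbed (L : R -> R) (t : R) (Z : R -> C) : Prop := {
  absorbed_cont : forall r, r < t -> Ccont Z r;
  absorbed_ode : forall r, 0 < r < t -> Cderiv Z r (2 / (Z r - L r))%C;
  absorbed_pos : forall r, r < t -> 0 < Im (Z r);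
  absorbed_lim : filterlim (fun r => Im (Z r)) (at_left t) (locally 0) }.

Lemma sum_sq_pos x y : 0 < y -> 0 < x * x + y * y.
Proof.
  intros Hy. pose proof (Rle_0_sqr x) as H. unfold Rsqr in H.
  pose proof (Rmult_lt_0_compat y y Hy Hy). lra.
Qed.

Lemma absorbed_parts L t Z r :
  absorbed L t Z -> 0 < r < t ->
  let x := Re (Z r) - L r in let y := Im (Z r) in
  is_derive (fun r => Re (Z r)) r (2 * x / (x * x + y * y)) /\
  is_derive (fun r => Im (Z r)) r (- 2 * y / (x * x + y * y)).
Proof.
  intros H Hr x y. destruct (absorbed_ode _ _ _ H r Hr) as [H1 H2].
  pose proof (absorbed_pos _ _ _ H r (proj2 Hr)) as Hy.
  destruct (Z r) as [p q] eqn:E. simpl in *.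
  assert (Hp : 0 < x * x + y * y). { subst x y. clear - Hy. pose proof (Rle_0_sqr (p - L r)) as Hs. unfold Rsqr in Hs. pose proof (Rmult_lt_0_compat q q Hy Hy). lra. } assert (Hn := Rgt_not_eq _ _ Hp).
  split; (eapply derive_eq; [eassumption|]); subst x y; simpl in *;
    replace (p + - L r) with (p - L r) by ring; field; nra.
Qed.

Lemma absorbed_neq L t Z r : absorbed L t Z -> r < t -> (Z r - L r)%C <> 0.
Proof.
  intros H Hr E. pose proof (absorbed_pos _ _ _ H r Hr).
  assert (Im (Z r - L r) = 0) by (rewrite E; reflexivity). unfold Im in *; simpl in *; lra.
Qed.

(** [Re Z] cannot outgrow [1 / Im Z]: by the equation,
    [(Re Z - L t)^2 + B ln (Im Z)] grows at most linearly, so [(Re Z)^2] is at most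
    of the order of [ln (1 / Im Z)]. *)
Lemma absorbed_im_re_lim L t Z c :
  0 < t -> sqrt_lipschitz L -> absorbed L t Z ->
  filterlim (fun r => Im (Z r) * (Re (Z r) - c)) (at_left t) (locally 0).
Proof.
  intros Ht HL H.
  set (B := sqrt t).
  assert (HB : 0 <= B) by apply sqrt_pos.
  assert (HLt : forall r, 0 < r < t -> Rabs (L r - L t) <= B).
  { intros r Hr. eapply Rle_trans; [apply HL|]. apply sqrt_le_1_alt.
    rewrite Rabs_left; lra. }
  pose (psi := fun r => (Re (Z r) - L t) * (Re (Z r) - L t) + B * ln (Im (Z r)) - (4 + 2 * B) * r).
  assert (Hpsi : forall r, t / 2 < r < t -> psi r <= psi (t/2)).
  { intros r Hr.
    pose (d := fun r => let x := Re (Z r) - L r in let y := Im (Z r) in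
       let N := x * x + y * y in
       4 * (Re (Z r) - L t) * x / N - 2 * B / N - (4 + 2 * B)).
    assert (0 - psi (t/2) <= 0 - psi r); [|lra].
    assert (Hder : forall s, 0 < s < t -> is_derive psi s (d s)).
    { intros s Hs. destruct (absorbed_parts L t Z s H Hs) as [H1 H2].
      pose proof (absorbed_pos _ _ _ H s (proj2 Hs)) as Hy. eapply derive_eq.
      - apply derive_minus; [apply derive_plus|].
        + apply derive_mult; (apply derive_minus; [exact H1 | apply derive_const]).
        + apply derive_mult; [apply derive_const|].
          apply (derive_comp ln). apply is_derive_ln. exact Hy. exact H2.
        + apply derive_mult; [apply derive_const | apply derive_id].
      - unfold d. cbv beta zeta. field.
        split; [|now apply Rgt_not_eq]. apply Rgt_not_eq.
        assert (0 < Im (Z s) * Im (Z s)) by nra.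
        pose proof (Rle_0_sqr (Re (Z s) - L s)). unfold Rsqr in *. lra. }
    apply (le_of_derive_nonneg (fun r => 0 - psi r) (fun r => 0 - d r)); [lra| | |].
    - intros s Hs. eapply derive_eq. apply derive_minus; [apply derive_const | apply Hder; lra].
      reflexivity.
    - intros s Hs. apply (continuous_minus (V := R_NormedModule)); [apply continuous_const|].
      eapply derive_continuous. apply Hder; lra.
    - intros s Hs. unfold d; cbv zeta. assert (Hs' : 0 < s < t) by lra.
      pose proof (absorbed_pos _ _ _ H s (proj2 Hs')) as Hy.
      pose proof (HLt s Hs') as Hl. apply Rabs_le_between in Hl.
      set (x := Re (Z s) - L s). set (y := Im (Z s)) in *.
      replace (Re (Z s) - L t) with (x + (L s - L t)) by (unfold x; ring).
      set (l := L s - L t) in *.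
      set (N := x * x + y * y).
      assert (HN : 0 < N) by (unfold N; nra).
      replace (0 - (4 * (x + l) * x / N - 2 * B / N - (4 + 2 * B)))
        with ((4 * (N - x * x) + 2 * (B * (N + 1) - 2 * l * x)) / N) by (field; lra).
      apply Rle_mult_inv_pos; [|lra].
      assert (Hx1 : 2 * l * x <= B * (x * x + 1)).
      { clear - Hl HB. assert (0 <= B * ((Rabs x - 1) * (Rabs x - 1))).
        { apply Rmult_le_pos; [exact HB | apply Rle_0_sqr]. }
        assert (l * x <= B * Rabs x).
        { eapply Rle_trans; [apply Rle_abs|]. rewrite Rabs_mult.
          apply Rmult_le_compat_r; [apply Rabs_pos | now apply Rabs_le]. }
        assert (Rabs x * Rabs x = x * x) by (rewrite <- Rabs_mult; apply Rabs_pos_eq, Rle_0_sqr).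
        nra. }
      assert (B * (x * x + 1) <= B * (N + 1)) by (apply Rmult_le_compat_l; unfold N; nra).
      unfold N at 1. nra. }
  assert (Hmain : filterlim (fun r => Im (Z r) * (Re (Z r) - L t)) (at_left t) (locally 0)).
  { pose (C1 := Rabs (psi (t/2)) + (4 + 2 * B) * t).
    apply (lim_zero_of_sq (at_left t) _ (fun r => C1 * (Im (Z r) * Im (Z r)) + B * Im (Z r))).
    - apply (at_left_imp t (t/2)); [lra|]. intros r Hr.
      pose proof (Hpsi r Hr) as Hp. unfold psi in Hp at 1.
      assert (Hr' : 0 < r < t) by lra.
      pose proof (absorbed_pos _ _ _ H r (proj2 Hr')) as Hy.
      set (y := Im (Z r)) in *. set (q := Re (Z r) - L t) in *.
      (* Any bound on the logarithm that is [o(1 / y^2)] would do. *)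
      assert (Hln : - ln y <= / y).
      { rewrite <- ln_Rinv by auto. assert (0 < / y) by now apply Rinv_0_lt_compat.
        pose proof (exp_ineq1_le (ln (/ y))). rewrite exp_ln in H1 by auto. lra. }
      assert (Hq : q * q <= C1 + B * / y).
      { unfold C1. pose proof (Rle_abs (psi (t/2))).
        assert (B * (- ln y) <= B * / y) by (apply Rmult_le_compat_l; auto).
        nra. }
      replace (y * q * (y * q)) with (y * y * (q * q)) by ring.
      replace (C1 * (y * y) + B * y) with (y * y * (C1 + B * / y)) by (field; lra).
      apply Rmult_le_compat_l; [nra | auto].
    - apply lim_eq with (C1 * (0 * 0) + B * 0); [|ring].
      pose proof (absorbed_lim _ _ _ H).
      apply (lim_plus (at_left t)); apply (lim_mult (at_left t)); try apply filterlim_const; auto.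
      apply (lim_mult (at_left t)); auto. }
  apply (filterlim_ext (fun r => Im (Z r) * (Re (Z r) - L t) + (L t - c) * Im (Z r))).
  { intros r. ring. }
  apply lim_eq with (0 + (L t - c) * 0); [|ring].
  apply (lim_plus (at_left t)); auto. apply (lim_mult (at_left t)); [apply filterlim_const|].
  apply (absorbed_lim _ _ _ H).
Qed.

Lemma absorbed_im_primitive L t Z :
  0 < t -> absorbed L t Z ->
  exists F : R -> R, (forall r, 0 < r < t -> is_derive F r (- Im (Z r))) /\
    filterlim F (at_left t) (locally 0).
Proof.
  intros Ht H.
  destruct (C0_extension_right (T := R_UniformSpace) (fun r => Im (Z r)) 0 0 t Ht) as [g [Hg1 [Hg2 Hg3]]].
  - intros c Hc. apply (absorbed_cont _ _ _ H c). lra.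
  - apply (absorbed_lim _ _ _ H).
  - assert (Hint : forall a, 0 < a -> ex_RInt (V := R_CompleteNormedModule) g a t).
    { intros a Ha. apply (ex_RInt_continuous (V := R_CompleteNormedModule)). intros z Hz.
      apply Hg1. revert Hz. unfold Rmin. destruct (Rle_dec a t); lra. }
    assert (Hd : forall r, 0 < r -> is_derive (fun a => RInt g a t) r (- g r)).
    { intros r Hr. apply (is_derive_RInt' g _ r t).
      - exists (mkposreal r Hr). intros a Ha. apply Rabs_lt_between' in Ha. simpl in Ha.
        apply (RInt_correct (V := R_CompleteNormedModule)). apply Hint. lra.
      - apply Hg1. lra. }
    exists (fun a => RInt g a t). split.
    + intros r Hr. rewrite <- Hg2 by lra. apply Hd; lra.
    + apply lim_at_left_cont.
      * eapply derive_continuous. now apply Hd.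
      * apply (RInt_point (V := R_CompleteNormedModule)).
Qed.

(** In reversed time [Re Z] is the average of the driving function with respect
    to [d (Im Z)], because [(Im Z * Re Z)' = (Im Z)' * L]; the square root
    modulus and Jensen's inequality then bound [Re Z - L].  Jensen is replaced
    by its tangent line [sqrt u <= (k + u / k) / 2]. *)
Lemma absorbed_re_le L t Z F r0 :
  sqrt_lipschitz L -> absorbed L t Z ->
  (forall r, 0 < r < t -> is_derive F r (- Im (Z r))) ->
  filterlim F (at_left t) (locally 0) ->
  0 < r0 < t ->
  Im (Z r0) * ((Re (Z r0) - L r0) * (Re (Z r0) - L r0)) <= F r0.
Proof.
  intros HL H HF HFl Hr0.
  assert (Ht : 0 < t) by lra.
  assert (HF0 : 0 <= F r0).
  { assert (0 - F r0 <= 0); [|lra].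
    apply (le_limit_of_derive_nonneg (fun r => 0 - F r) (fun r => 0 - - Im (Z r)) r0 t); [lra| | |].
    - intros r Hr. apply derive_minus; [apply derive_const | apply HF; lra].
    - intros r Hr. pose proof (absorbed_pos _ _ _ H r (proj2 Hr)). lra.
    - apply lim_eq with (0 - 0); [|ring]. apply (lim_minus (at_left t)); auto. apply filterlim_const. }
  assert (Hy0 := absorbed_pos _ _ _ H r0 (proj2 Hr0)).
  assert (Hkey : forall sg k, sg * sg = 1 -> 0 < k ->
    sg * (Im (Z r0) * (Re (Z r0) - L r0)) <= / 2 * (k * Im (Z r0) + F r0 / k)).
  { intros sg k Hsg Hk.
    pose (phi := fun r => sg * (Im (Z r) * (Re (Z r) - L r0))
       - / 2 * (k * Im (Z r) + ((r - r0) * Im (Z r) + F r) * / k)).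
    assert (Hphi : phi r0 <= 0).
    { apply (le_limit_of_derive_nonneg phi
        (fun r => let x := Re (Z r) - L r in let y := Im (Z r) in
          2 * y / (x * x + y * y) * (/ 2 * (k + (r - r0) * / k) - sg * (L r - L r0))) r0 t); [lra| | |].
      - intros r Hr. assert (Hr' : 0 < r < t) by lra.
        destruct (absorbed_parts L t Z r H Hr') as [H1 H2].
        pose proof (absorbed_pos _ _ _ H r (proj2 Hr)) as Hy.
        pose proof (sum_sq_pos (Re (Z r) - L r) _ Hy) as HN. eapply derive_eq.
        + apply derive_minus; (apply derive_mult; [apply derive_const|]).
          * apply derive_mult; [exact H2 | apply derive_minus; [exact H1 | apply derive_const]].
          * apply derive_plus; [apply derive_mult; [apply derive_const | exact H2]|].
            apply derive_mult; [|apply derive_const].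
            apply derive_plus; [apply derive_mult; [|exact H2] | apply HF; auto].
            apply derive_minus; [apply derive_id | apply derive_const].
        + cbv beta zeta. field. split; now apply Rgt_not_eq.
      - intros r Hr. cbv zeta. pose proof (absorbed_pos _ _ _ H r (proj2 Hr)) as Hy.
        pose proof (sum_sq_pos (Re (Z r) - L r) _ Hy) as HN.
        apply Rmult_le_pos.
        + apply Rle_mult_inv_pos; [lra | exact HN].
        + assert (Hsl : sg * (L r - L r0) <= sqrt (r - r0)).
          { eapply Rle_trans; [apply Rle_abs|]. rewrite Rabs_mult.
            replace (Rabs sg) with 1. rewrite Rmult_1_l.
            rewrite <- (Rabs_pos_eq (r - r0)) by lra. apply HL.
            unfold Rabs. destruct (Rcase_abs sg); nra. }
          assert (Hst : sqrt (r - r0) <= / 2 * (k + (r - r0) * / k)).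
          { pose proof (sqrt_sqrt (r - r0)) as Hss. set (s := sqrt (r - r0)) in *.
            rewrite <- Hss by lra.
            assert (0 <= (k - s) * (k - s) * / k).
            { apply Rmult_le_pos; [apply Rle_0_sqr | left; now apply Rinv_0_lt_compat]. }
            replace ((k - s) * (k - s) * / k) with (k - 2 * s + s * s * / k) in H0 by (field; lra).
            lra. }
          lra.
      - unfold phi. apply lim_eq with (sg * 0 - / 2 * (k * 0 + ((t - r0) * 0 + 0) * / k)); [|ring].
        pose proof (absorbed_lim _ _ _ H) as Hl.
        apply (lim_minus (at_left t)).
        + apply (lim_mult (at_left t)); [apply filterlim_const|].
          now apply (absorbed_im_re_lim L t Z (L r0)).
        + apply (lim_mult (at_left t)); [apply filterlim_const|].
          apply (lim_plus (at_left t)); apply (lim_mult (at_left t));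
            try apply filterlim_const; auto.
          apply (lim_plus (at_left t)); [apply (lim_mult (at_left t)); auto | auto].
          apply lim_at_left_cont; auto. eapply derive_continuous.
          apply derive_minus; [apply derive_id | apply derive_const]. }
    unfold phi in Hphi. replace (r0 - r0) with 0 in Hphi by ring.
    unfold Rdiv. lra. }
  (* The best tangent point is [k = |x|]. *)
  set (x := Re (Z r0) - L r0) in *. set (y := Im (Z r0)) in *.
  destruct (total_order_T x 0) as [[Hx | Hx] | Hx].
  - specialize (Hkey (-1) (- x) ltac:(ring) ltac:(lra)).
    replace (/ 2 * (- x * y + F r0 / - x)) with (/ 2 * ((- x * y * - x + F r0) * / - x)) in Hkey by (field; lra).
    assert ((-1 * (y * x)) * - x <= (/ 2 * ((- x * y * - x + F r0) * / - x)) * - x)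
      by (apply Rmult_le_compat_r; lra).
    replace ((/ 2 * ((- x * y * - x + F r0) * / - x)) * - x) with (/ 2 * (- x * y * - x + F r0)) in H0 by (field; lra).
    lra.
  - rewrite Hx. lra.
  - specialize (Hkey 1 x ltac:(ring) ltac:(lra)).
    replace (/ 2 * (x * y + F r0 / x)) with (/ 2 * ((x * y * x + F r0) * / x)) in Hkey by (field; lra).
    assert ((1 * (y * x)) * x <= (/ 2 * ((x * y * x + F r0) * / x)) * x)
      by (apply Rmult_le_compat_r; lra).
    replace ((/ 2 * ((x * y * x + F r0) * / x)) * x) with (/ 2 * (x * y * x + F r0)) in H0 by (field; lra).
    lra.
Qed.

(** By [absorbed_re_le], [|Z - L|^2 <= F / Im Z + (Im Z)^2], where [F] is the
    integral of [Im Z] over the remaining time.  Inserted into the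
    equation for [Im Z], this is a differential inequality that integrates to the
    vertical bound.  The size of the Lip(1/2) constant enters here: with constant
    [c] instead of 1 the same argument gives [4 - 2 c^2] in place of [2]. *)
Lemma absorbed_bounds L t Z r0 :
  sqrt_lipschitz L -> absorbed L t Z -> 0 < r0 < t ->
  2 * (t - r0) <= Im (Z r0) * Im (Z r0) /\
  (Re (Z r0) - L r0) * (Re (Z r0) - L r0) <= t - r0.
Proof.
  intros HL H Hr0. assert (Ht : 0 < t) by lra.
  destruct (absorbed_im_primitive L t Z Ht H) as [F [HF HFl]].
  pose proof (fun r Hr => absorbed_re_le L t Z F r HL H HF HFl Hr) as Hre.
  pose proof (absorbed_lim _ _ _ H) as Hl.
  assert (Htr : filterlim (fun r => t - r) (at_left t) (locally 0)).
  { apply lim_at_left_cont; [|ring]. eapply derive_continuous.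
    apply derive_minus; [apply derive_const | apply derive_id]. }
  assert (HFle : forall r, 0 < r < t -> F r <= (t - r) * Im (Z r)).
  { intros r1 Hr1. assert (F r1 - (t - r1) * Im (Z r1) <= 0); [|lra].
    apply (le_limit_of_derive_nonneg (fun r => F r - (t - r) * Im (Z r))
      (fun r => let x := Re (Z r) - L r in let y := Im (Z r) in
         (t - r) * (2 * y / (x * x + y * y))) r1 t); [lra| | |].
    - intros r Hr. assert (Hr' : 0 < r < t) by lra.
      destruct (absorbed_parts L t Z r H Hr') as [_ H2].
      pose proof (absorbed_pos _ _ _ H r (proj2 Hr)) as Hy.
      pose proof (sum_sq_pos (Re (Z r) - L r) _ Hy) as HN. eapply derive_eq.
      + apply derive_minus; [apply HF; auto|].
        apply derive_mult; [|exact H2]. apply derive_minus; [apply derive_const|apply derive_id].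
      + cbv beta zeta. field. now apply Rgt_not_eq.
    - intros r Hr. cbv zeta. pose proof (absorbed_pos _ _ _ H r (proj2 Hr)) as Hy.
      pose proof (sum_sq_pos (Re (Z r) - L r) _ Hy) as HN.
      apply Rmult_le_pos; [lra|]. apply Rle_mult_inv_pos; [lra|auto].
    - apply lim_eq with (0 - 0 * 0); [|ring]. apply (lim_minus (at_left t)); auto.
      apply (lim_mult (at_left t)); auto. }
  assert (HF0 : forall r, 0 < r < t -> 0 <= F r).
  { intros r Hr. eapply Rle_trans; [|apply Hre; auto].
    apply Rmult_le_pos; [|apply Rle_0_sqr]. left. apply (absorbed_pos _ _ _ H r); lra. }
  pose proof (absorbed_pos _ _ _ H r0 (proj2 Hr0)) as Hy0.
  assert (Hx2 : (Re (Z r0) - L r0) * (Re (Z r0) - L r0) <= t - r0).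
  { pose proof (Hre r0 Hr0). pose proof (HFle r0 Hr0).
    apply Rmult_le_reg_l with (Im (Z r0)); auto. lra. }
  split; [|exact Hx2].
  (* The derivative of [K] is a positive multiple of [F / Im Z - (Re Z - L)^2],
     which [absorbed_re_le] makes nonnegative. *)
  pose (K := fun r => F r * / Im (Z r) - / 2 * (Im (Z r) * Im (Z r)) + (t - r)).
  assert (HK : K r0 <= 0).
  { apply (le_limit_of_derive_nonneg K
      (fun r => let x := Re (Z r) - L r in let y := Im (Z r) in
         2 * / (x * x + y * y) * (F r * / y - x * x)) r0 t); [lra| | |].
    - intros r Hr. assert (Hr' : 0 < r < t) by lra.
      destruct (absorbed_parts L t Z r H Hr') as [_ H2].
      pose proof (absorbed_pos _ _ _ H r (proj2 Hr)) as Hy.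
      pose proof (sum_sq_pos (Re (Z r) - L r) _ Hy) as HN. eapply derive_eq.
      + apply derive_plus; [apply derive_minus; apply derive_mult|].
        * apply HF; auto.
        * apply is_derive_inv; [exact H2 | now apply Rgt_not_eq].
        * apply derive_const.
        * apply derive_mult; exact H2.
        * apply derive_minus; [apply derive_const|apply derive_id].
      + cbv beta zeta. field. split; now apply Rgt_not_eq.
    - intros r Hr. cbv zeta. pose proof (absorbed_pos _ _ _ H r (proj2 Hr)) as Hy.
      pose proof (sum_sq_pos (Re (Z r) - L r) _ Hy) as HN.
      apply Rmult_le_pos; [apply Rmult_le_pos; [lra|left; now apply Rinv_0_lt_compat]|].
      assert (Hr' : 0 < r < t) by lra. pose proof (Hre r Hr').
      apply Rmult_le_compat_r with (r := / Im (Z r)) in H0; [|left; now apply Rinv_0_lt_compat].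
      replace (Im (Z r) * ((Re (Z r) - L r) * (Re (Z r) - L r)) * / Im (Z r))
        with ((Re (Z r) - L r) * (Re (Z r) - L r)) in H0 by (field; lra).
      lra.
    - apply lim_eq with (0 - / 2 * (0 * 0) + 0); [|ring]. unfold K.
      apply (lim_plus (at_left t)); auto. apply (lim_minus (at_left t)).
      + apply (filterlim_le_le (F := at_left t) (fun _ => 0) _ (fun r => t - r) (Finite 0)).
        * apply (at_left_imp t 0); auto. intros r Hr.
          pose proof (absorbed_pos _ _ _ H r (proj2 Hr)) as Hy.
          assert (0 <= / Im (Z r)) by (left; now apply Rinv_0_lt_compat).
          split. apply Rmult_le_pos; auto.
          apply Rle_trans with ((t - r) * Im (Z r) * / Im (Z r)).
          apply Rmult_le_compat_r; auto. right; field; lra.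
        * apply filterlim_const.
        * exact Htr.
      + apply (lim_mult (at_left t)); [apply filterlim_const|]. apply (lim_mult (at_left t)); auto. }
  assert (0 <= F r0 * / Im (Z r0)).
  { apply Rmult_le_pos; auto. left; now apply Rinv_0_lt_compat. }
  unfold K in HK. lra.
Qed.

Lemma absorbed_Cmod_ge L t Z r :
  sqrt_lipschitz L -> absorbed L t Z -> 0 < r < t ->
  sqrt (t - r) <= Cmod (Z r - L r).
Proof.
  intros HL H Hr. destruct (absorbed_bounds L t Z r HL H Hr) as [H1 _].
  pose proof (absorbed_pos _ _ _ H r (proj2 Hr)) as Hy.
  eapply Rle_trans; [|apply Cmod_Im_ge].
  replace (Im (Z r - L r)) with (Im (Z r)) by (unfold Im; simpl; ring).
  rewrite Rabs_pos_eq by lra. rewrite <- (sqrt_Rsqr (Im (Z r))) by lra.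
  apply sqrt_le_1_alt. unfold Rsqr. lra.
Qed.

(** The trajectory for the zero driving function, seen from its tip: the slit is
    the vertical segment of height [2 sqrt t]. *)
Definition straight (t r : R) : C := (0, 2 * sqrt (t - r)).

Lemma straight_sq t r : r <= t -> (straight t r * straight t r = - (4 * (t - r))%R)%C.
Proof.
  intros H. unfold straight. apply injective_projections; simpl; [|ring].
  pose proof (sqrt_sqrt (t - r)). nra.
Qed.

Lemma Cmod_straight t r : Cmod (straight t r) = 2 * sqrt (t - r).
Proof.
  unfold Cmod, straight; simpl.
  replace (0 * (0 * 1) + 2 * sqrt (t - r) * (2 * sqrt (t - r) * 1)) with (Rsqr (2 * sqrt (t - r))) by (unfold Rsqr; ring).
  apply sqrt_Rsqr. pose proof (sqrt_pos (t - r)). lra.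
Qed.

Lemma straight_neq t r : r < t -> straight t r <> 0.
Proof.
  intros H E. apply (f_equal Im) in E. unfold straight, Im in E; simpl in E.
  pose proof (sqrt_lt_R0 (t - r)). lra.
Qed.

Lemma Cderiv_straight t r : r < t -> Cderiv (straight t) r (2 / straight t r)%C.
Proof.
  intros H. assert (Hs : 0 < sqrt (t - r)) by (apply sqrt_lt_R0; lra).
  assert (E : (2 / straight t r = (0, - / sqrt (t - r))%R)%C).
  { unfold straight. apply injective_projections; simpl; field; lra. }
  rewrite E. split; unfold straight, Re, Im; simpl.
  - apply derive_const.
  - eapply derive_eq.
    + apply derive_mult; [apply derive_const|]. apply is_derive_sqrt; [|lra].
      apply derive_minus; [apply derive_const|apply derive_id].
    + cbv beta. field. lra.
Qed.

(** Compare [(Z - L t)^2], whose derivative is [4 + 4 (L - L t) / (Z - L)], with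
    [-4 (t - r)]: by [absorbed_Cmod_ge] the perturbation is [O((t - r)^delta)].
    Both square roots lie in the upper half plane, so the difference of the squares
    controls the difference of the roots. *)
Lemma absorbed_near_straight M delta L t Z r0 :
  0 < M -> 0 < delta -> sqrt_lipschitz L -> holder M delta L ->
  absorbed L t Z -> 0 < r0 < t ->
  Cmod (Z r0 - L r0 - straight t r0) <=
    3 * M * (sqrt (t - r0) * Rpower (t - r0) delta).
Proof.
  intros HM Hdelta HL HH H Hr0.
  assert (Hdist : forall r, 0 < r < t -> Rabs (L r - L t) <= M * (sqrt (t - r) * Rpower (t - r) delta)).
  { intros r Hr. replace (t - r) with (Rabs (r - t)) by (rewrite Rabs_left; lra). apply HH; lra. }
  assert (Ht : 0 < t) by lra.
  assert (Hy0 := absorbed_lim _ _ _ H).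
  assert (Hu0 : filterlim (fun r => t - r) (at_left t) (locally 0)).
  { apply lim_at_left_cont; [|ring]. eapply derive_continuous.
    apply derive_minus; [apply derive_const | apply derive_id]. }
  assert (Hx0 : filterlim (fun r => Re (Z r) - L t) (at_left t) (locally 0)).
  { apply (lim_zero_of_sq (at_left t) _ (fun r => 4 * (t - r))).
    - apply (at_left_imp t 0); auto. intros r Hr.
      destruct (absorbed_bounds L t Z r HL H Hr) as [_ H2].
      assert (H3 : (L r - L t) * (L r - L t) <= t - r).
      { rewrite <- (sqrt_sqrt (t - r)) by lra.
        replace ((L r - L t) * (L r - L t)) with (Rabs (L r - L t) * Rabs (L r - L t))
          by (rewrite <- Rabs_mult; apply Rabs_pos_eq, Rle_0_sqr).
        assert (Rabs (L r - L t) <= sqrt (t - r)).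
        { replace (t - r) with (Rabs (r - t)) by (rewrite Rabs_left; lra). apply HL. }
        pose proof (Rabs_pos (L r - L t)). apply Rmult_le_compat; lra. }
      pose proof (Rle_0_sqr ((Re (Z r) - L r) - (L r - L t))) as Hq. unfold Rsqr in Hq. nra.
    - apply lim_eq with (4 * 0); [|ring]. apply (lim_mult (at_left t)); auto. apply filterlim_const. }
  pose (W := fun r => (Z r - L t)%C).
  pose (V := fun r => (W r * W r + (4 * (t - r))%R)%C).
  pose (k := - (4 * M / (1 + delta))).
  assert (HV : Cmod (V r0) <= - (k * Rpower (t - r0) (1 + delta))).
  { apply (Cmod_le_to_zero V (fun r => (4 * (L r - L t)%R / (Z r - L r))%C)
      (fun r => k * Rpower (t - r) (1 + delta)) (fun r => 4 * M * Rpower (t - r) delta) r0 t).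
    - lra.
    - intros r Hr. assert (Hr' : 0 < r < t) by lra.
      pose proof (absorbed_neq L t Z r H (proj2 Hr)) as Hne.
      eapply Cderiv_eq.
      + apply Cderiv_plus.
        * apply Cderiv_mult; (apply Cderiv_minus; [apply (absorbed_ode _ _ _ H r Hr') | apply Cderiv_const]).
        * assert (Hc : Cderiv (fun r => RtoC (4 * (t - r))) r (RtoC (-4))).
          { split; simpl; [|apply derive_const]. eapply derive_eq.
            apply derive_mult; [apply derive_const|]. apply derive_minus; [apply derive_const|apply derive_id].
            cbv beta; ring. }
          exact Hc.
      + cbv beta. unfold W. replace (-4) with (- (4)) by ring.
        rewrite RtoC_opp, RtoC_minus. field. exact Hne.
    - intros r Hr. assert (Hr' : 0 < r < t) by lra. eapply derive_eq.
      + apply derive_mult; [apply derive_const | apply derive_Rpower_rev; lra].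
      + cbv beta. unfold k. rewrite Rpower_plus, Rpower_1 by lra. field. lra.
    - intros r Hr. assert (Hr' : 0 < r < t) by lra.
      pose proof (absorbed_neq L t Z r H (proj2 Hr)) as Hne.
      rewrite Cmod_div, Cmod_mult by auto. rewrite 2!Cmod_R, (Rabs_pos_eq 4) by lra.
      assert (Hs : 0 < sqrt (t - r)) by (apply sqrt_lt_R0; lra).
      pose proof (absorbed_Cmod_ge L t Z r HL H Hr') as Hge.
      apply Rle_div_l; [lra|].
      pose proof (Hdist r Hr'). pose proof (Rpower_pos (t - r) delta).
      apply Rle_trans with (4 * M * Rpower (t - r) delta * sqrt (t - r)); [lra|].
      apply Rmult_le_compat_l; [|exact Hge]. apply Rmult_le_pos; lra.
    - apply lim_eq with (0 * 0 - 0 * 0 + 4 * 0); [|ring].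
      apply (filterlim_ext (fun r => (Re (Z r) - L t) * (Re (Z r) - L t) - Im (Z r) * Im (Z r) + 4 * (t - r))).
      { intros r. unfold V, W, Re, Im; simpl; ring. }
      apply (lim_plus (at_left t)); [apply (lim_minus (at_left t)); apply (lim_mult (at_left t)); auto|].
      apply (lim_mult (at_left t)); [apply filterlim_const | exact Hu0].
    - apply lim_eq with (2 * (0 * 0)); [|ring].
      apply (filterlim_ext (fun r => 2 * ((Re (Z r) - L t) * Im (Z r)))).
      { intros r. unfold V, W, Re, Im; simpl; ring. }
      apply (lim_mult (at_left t)); [apply filterlim_const|apply (lim_mult (at_left t)); auto].
    - apply lim_eq with (k * 0); [|ring]. apply (lim_mult (at_left t)); [apply filterlim_const|].
      apply (filterlim_comp _ _ _ (fun r => t - r) (fun u => Rpower u (1 + delta)) _ (at_right 0)).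
      apply at_left_rev. apply lim_Rpower_0. lra. }
  set (u := t - r0) in *. assert (Hu : 0 < u) by (unfold u; lra).
  assert (Hs : 0 < sqrt u) by now apply sqrt_lt_R0.
  assert (Hss : sqrt u * sqrt u = u) by (apply sqrt_sqrt; lra).
  pose proof (Rpower_pos u delta) as Hw.
  assert (HV' : Cmod (V r0) <= 4 * M * (u * Rpower u delta)).
  { eapply Rle_trans; [exact HV|]. unfold k. rewrite Rpower_plus, Rpower_1 by auto.
    replace (- (- (4 * M / (1 + delta)) * (u * Rpower u delta)))
      with (4 * M * (u * Rpower u delta) / (1 + delta)) by (field; lra).
    assert (0 < 4 * M * (u * Rpower u delta)).
    { apply Rmult_lt_0_compat; [lra|]. now apply Rmult_lt_0_compat. }
    apply Rle_div_l; nra. }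
  assert (HVf : V r0 = ((W r0 - straight t r0) * (W r0 + straight t r0))%C).
  { unfold V. transitivity (W r0 * W r0 - straight t r0 * straight t r0)%C; [|ring].
    rewrite straight_sq by lra. ring. }
  rewrite HVf, Cmod_mult in HV'.
  assert (Hplus : 2 * sqrt u <= Cmod (W r0 + straight t r0)).
  { eapply Rle_trans; [|apply Cmod_Im_ge].
    pose proof (absorbed_pos _ _ _ H r0 (proj2 Hr0)).
    replace (Im (W r0 + straight t r0)) with (Im (Z r0) + 2 * sqrt u) by (unfold W, Im, u; simpl; ring).
    rewrite Rabs_pos_eq; lra. }
  assert (HW : Cmod (W r0 - straight t r0) <= 2 * M * (sqrt u * Rpower u delta)).
  { apply Rmult_le_reg_r with (2 * sqrt u); [lra|].
    replace (2 * M * (sqrt u * Rpower u delta) * (2 * sqrt u)) with (4 * M * (u * Rpower u delta))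
      by (transitivity (4 * M * ((sqrt u * sqrt u) * Rpower u delta)); [rewrite Hss|]; ring).
    eapply Rle_trans; [|exact HV']. apply Rmult_le_compat_l; [apply Cmod_ge_0|auto]. }
  replace (Z r0 - L r0 - straight t r0)%C with ((W r0 - straight t r0) + RtoC (L t - L r0))%C
    by (unfold W; rewrite RtoC_minus; ring).
  eapply Rle_trans; [apply Cmod_triangle|]. rewrite Cmod_R, Rabs_minus_sym.
  pose proof (Hdist r0 Hr0). fold u in H0. lra.
Qed.

(** * Comparison of two trajectories *)

(** The difference of the trajectories absorbed at [s] and at [t] has logarithmic
    derivative [-2 / (Xs Xt)], where [X = Z - L]; [kern] measures, up to sign,
    how far this is from its value for the straight slit. *)
Definition kern (L : R -> R) (s t : R) (Zs Zt : R -> C) (r : R) : C :=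
  (2 / ((Zs r - L r) * (Zt r - L r)) - 2 / (straight s r * straight t r))%C.

Lemma Cmod_frac3_le (d p q r : C) (D P Q W : R) :
  0 < P -> 0 < Q -> 0 < W -> P <= Cmod p -> Q <= Cmod q -> W <= Cmod r ->
  Cmod d <= D -> Cmod (2 * d / (p * q * r))%C <= 2 * D / (P * Q * W).
Proof.
  intros HP HQ HW Hp Hq Hr Hd.
  assert (Hne : forall z, 0 < Cmod z -> z <> 0) by (intros z; apply Cmod_gt_0).
  assert (p <> 0 /\ q <> 0 /\ r <> 0) as [Np [Nq Nr]] by (repeat split; apply Hne; lra).
  rewrite Cmod_div, !Cmod_mult, Cmod_R, Rabs_pos_eq by (try lra; repeat apply Cmult_neq_0; auto).
  assert (HPQ : P * Q <= Cmod p * Cmod q) by (apply Rmult_le_compat; lra).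
  assert (HPQW : P * Q * W <= Cmod p * Cmod q * Cmod r).
  { apply Rmult_le_compat; try lra. left; now apply Rmult_lt_0_compat. }
  assert (0 < P * Q * W) by (repeat apply Rmult_lt_0_compat; auto).
  pose proof (Cmod_ge_0 d).
  unfold Rdiv. apply Rmult_le_compat; try lra.
  - left; apply Rinv_0_lt_compat; lra.
  - apply Rinv_le_contravar; lra.
Qed.

(** Each factor [Z - L] has relative error [O(u^delta)] with respect to the
    straight one, and the product of two straight factors is at least of order [u].
    The resulting bound is integrable at [u = 0]. *)
Lemma kern_le M delta L s t Zs Zt u r :
  0 < M -> 0 < delta <= 1 / 2 -> sqrt_lipschitz L -> holder M delta L ->
  absorbed L s Zs -> absorbed L t Zt ->
  0 < r -> 0 < u -> u <= s - r -> u <= t - r ->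
  Cmod (kern L s t Zs Zt r) <= 6 * M * (Rpower u delta / u).
Proof.
  intros HM Hd HL HH Hs Ht Hr Hu Hus Hut.
  pose proof (absorbed_near_straight M delta L s Zs r HM (proj1 Hd) HL HH Hs ltac:(lra)) as Ds.
  pose proof (absorbed_near_straight M delta L t Zt r HM (proj1 Hd) HL HH Ht ltac:(lra)) as Dt.
  pose proof (absorbed_Cmod_ge L s Zs r HL Hs ltac:(lra)) as Gs.
  pose proof (absorbed_Cmod_ge L t Zt r HL Ht ltac:(lra)) as Gt.
  pose proof (absorbed_neq L s Zs r Hs ltac:(lra)) as Ns.
  pose proof (absorbed_neq L t Zt r Ht ltac:(lra)) as Nt.
  pose proof (straight_neq s r ltac:(lra)) as ns.
  pose proof (straight_neq t r ltac:(lra)) as nt.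
  pose proof (Cmod_straight s r) as cs. pose proof (Cmod_straight t r) as ct.
  assert (E : kern L s t Zs Zt r =
    (2 * (straight s r - (Zs r - L r)) / ((Zs r - L r) * (Zt r - L r) * straight s r) +
     2 * (straight t r - (Zt r - L r)) / ((Zt r - L r) * straight s r * straight t r))%C).
  { unfold kern. field. repeat split; auto. }
  rewrite E. clear E.
  assert (ps : 0 < sqrt (s - r)) by (apply sqrt_lt_R0; lra).
  assert (pt : 0 < sqrt (t - r)) by (apply sqrt_lt_R0; lra).
  assert (pu : 0 < sqrt u) by (apply sqrt_lt_R0; lra).
  assert (us : sqrt u <= sqrt (s - r)) by (apply sqrt_le_1_alt; lra).
  assert (ut : sqrt u <= sqrt (t - r)) by (apply sqrt_le_1_alt; lra).
  pose proof (Rpower_div_sqrt_decr u (s - r) delta ltac:(lra) (proj2 Hd)) as ws.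
  pose proof (Rpower_div_sqrt_decr u (t - r) delta ltac:(lra) (proj2 Hd)) as wt.
  assert (Hinv : forall x, sqrt u <= x -> / x <= / sqrt u) by (intros; apply Rinv_le_contravar; lra).
  assert (Hss : sqrt u * sqrt u = u) by (apply sqrt_sqrt; lra).
  assert (W0 : 0 < Rpower u delta / sqrt u).
  { apply Rmult_lt_0_compat; [apply Rpower_pos | now apply Rinv_0_lt_compat]. }
  assert (Wu : Rpower u delta / u = Rpower u delta / sqrt u * / sqrt u).
  { rewrite <- Hss at 2. field. lra. }
  assert (B : forall a b, 0 < a -> Rpower a delta / sqrt a <= Rpower u delta / sqrt u ->
     sqrt u <= b -> Rpower a delta / sqrt a * / b <= Rpower u delta / u).
  { intros a b Ha H1 H2. rewrite Wu. apply Rmult_le_compat; auto.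
    - apply Rle_mult_inv_pos; [left; apply Rpower_pos | now apply sqrt_lt_R0].
    - left; apply Rinv_0_lt_compat; lra. }
  pose proof (B (s - r) (sqrt (t - r)) ltac:(lra) ws ut) as B1.
  pose proof (B (t - r) (sqrt (s - r)) ltac:(lra) wt us) as B2.
  eapply Rle_trans; [apply Cmod_triangle|].
  assert (T1 := Cmod_frac3_le (straight s r - (Zs r - L r)) (Zs r - L r) (Zt r - L r) (straight s r)
    (3 * M * (sqrt (s - r) * Rpower (s - r) delta)) (sqrt (s - r)) (sqrt (t - r)) (2 * sqrt (s - r))
    ps pt ltac:(lra) Gs Gt ltac:(lra)).
  assert (T2 := Cmod_frac3_le (straight t r - (Zt r - L r)) (Zt r - L r) (straight s r) (straight t r)
    (3 * M * (sqrt (t - r) * Rpower (t - r) delta)) (sqrt (t - r)) (2 * sqrt (s - r)) (2 * sqrt (t - r))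
    pt ltac:(lra) ltac:(lra) Gt ltac:(lra) ltac:(lra)).
  rewrite <- Cmod_opp in Ds. rewrite <- Cmod_opp in Dt.
  replace (- (Zs r - L r - straight s r))%C with (straight s r - (Zs r - L r))%C in Ds by ring.
  replace (- (Zt r - L r - straight t r))%C with (straight t r - (Zt r - L r))%C in Dt by ring.
  specialize (T1 Ds). specialize (T2 Dt).
  replace (2 * (3 * M * (sqrt (s - r) * Rpower (s - r) delta)) / (sqrt (s - r) * sqrt (t - r) * (2 * sqrt (s - r))))
    with (3 * M * (Rpower (s - r) delta / sqrt (s - r) * / sqrt (t - r))) in T1 by (field; lra).
  replace (2 * (3 * M * (sqrt (t - r) * Rpower (t - r) delta)) / (sqrt (t - r) * (2 * sqrt (s - r)) * (2 * sqrt (t - r))))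
    with (3 / 2 * M * (Rpower (t - r) delta / sqrt (t - r) * / sqrt (s - r))) in T2 by (field; lra).
  assert (0 < Rpower u delta / u) by (rewrite Wu; apply Rmult_lt_0_compat; auto; now apply Rinv_0_lt_compat).
  eapply Rle_trans; [apply Rplus_le_compat; [exact T1 | exact T2]|].
  apply Rle_trans with (3 * M * (Rpower u delta / u) + 3 / 2 * M * (Rpower u delta / u)).
  - apply Rplus_le_compat; apply Rmult_le_compat_l; lra.
  - assert (0 < M * (Rpower u delta / u)) by now apply Rmult_lt_0_compat. lra.
Qed.

Lemma Cmod_straight_gap s t r :
  r < s -> r < t ->
  Cmod (straight t r - straight s r) = 2 * Rabs (t - s) / (sqrt (t - r) + sqrt (s - r)).
Proof.
  intros Hs Ht.
  assert (ps : 0 < sqrt (s - r)) by (apply sqrt_lt_R0; lra).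
  assert (pt : 0 < sqrt (t - r)) by (apply sqrt_lt_R0; lra).
  assert (E : (straight t r - straight s r = Ci * RtoC (2 * (t - s) / (sqrt (t - r) + sqrt (s - r))))%C).
  { unfold straight. apply injective_projections; simpl; [ring|].
    replace (t - s) with (sqrt (t - r) * sqrt (t - r) - sqrt (s - r) * sqrt (s - r))
      by (rewrite !sqrt_sqrt; lra).
    field. lra. }
  rewrite E, Cmod_mult, Cmod_R. unfold Rdiv. rewrite !Rabs_mult, (Rabs_pos_eq 2) by lra.
  rewrite (Rabs_pos_eq (/ _)) by (left; apply Rinv_0_lt_compat; lra).
  rewrite Cmod_Ci. ring.
Qed.

Lemma straight_gap_neq s t r : r < s -> r < t -> s <> t -> (straight t r - straight s r)%C <> 0.
Proof.
  intros Hs Ht Hne. apply Cmod_gt_0. rewrite Cmod_straight_gap by auto.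
  assert (ps : 0 < sqrt (s - r)) by (apply sqrt_lt_R0; lra).
  assert (pt : 0 < sqrt (t - r)) by (apply sqrt_lt_R0; lra).
  apply Rdiv_lt_0_compat; [|lra]. assert (0 < Rabs (t - s)) by (apply Rabs_pos_lt; lra). lra.
Qed.

Lemma straight_gap_0 s t : 0 < s -> 0 < t ->
  (straight t 0 - straight s 0 = RtoC (t - s) * (Ci * RtoC (2 / (sqrt t + sqrt s))))%C.
Proof.
  intros Hs Ht. pose proof (sqrt_lt_R0 s Hs). pose proof (sqrt_lt_R0 t Ht).
  unfold straight. rewrite !Rminus_0_r.
  apply injective_projections; simpl; [ring|].
  replace (t - s) with (sqrt t * sqrt t - sqrt s * sqrt s) by (rewrite !sqrt_sqrt; lra).
  field. lra.
Qed.

(** Dividing by the straight gap turns the singular equation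
    [Q' = - 2 Q / (Xs Xt)] of the gap into one whose rate, [kern], is integrable
    uniformly in [s] and [t]. *)
Definition ratio (s t : R) (Zs Zt : R -> C) (r : R) : C :=
  ((Zt r - Zs r) / (straight t r - straight s r))%C.

Lemma Cderiv_ratio L s t Zs Zt r :
  absorbed L s Zs -> absorbed L t Zt -> s <> t -> 0 < r -> r < s -> r < t ->
  Cderiv (ratio s t Zs Zt) r (- kern L s t Zs Zt r * ratio s t Zs Zt r)%C.
Proof.
  intros Hs Ht Hne Hr Hrs Hrt. eapply Cderiv_eq.
  - apply Cderiv_mult.
    + apply Cderiv_minus; [apply (absorbed_ode _ _ _ Ht r) | apply (absorbed_ode _ _ _ Hs r)]; lra.
    + apply Cderiv_inv.
      * apply Cderiv_minus; now apply Cderiv_straight.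
      * now apply straight_gap_neq.
  - cbv beta. unfold ratio, kern.
    pose proof (absorbed_neq L s Zs r Hs Hrs). pose proof (absorbed_neq L t Zt r Ht Hrt).
    pose proof (straight_neq s r Hrs). pose proof (straight_neq t r Hrt).
    pose proof (straight_gap_neq s t r Hrs Hrt Hne).
    field. repeat split; auto.
Qed.

Lemma Cmod_le_of_sq a b e : 1 <= e -> 0 <= b -> 0 <= a -> a * a <= b * b * e -> a <= b * e.
Proof.
  intros He Hb Ha H. apply Rsqr_incr_0_var; [unfold Rsqr|apply Rmult_le_pos; lra].
  assert (b * b * e <= b * b * (e * e)); [|lra].
  apply Rmult_le_compat_l; [apply Rle_0_sqr|nra].
Qed.

(** Gronwall's inequality for [|ratio|^2], with the integrable rate of [kern_le]. *)
Lemma ratio_growth_le M delta T L s t Zs Zt r r0 :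
  0 < M -> 0 < delta <= 1 / 2 -> sqrt_lipschitz L -> holder M delta L ->
  absorbed L s Zs -> absorbed L t Zt -> s <> t -> s <= T ->
  0 < r <= r0 -> r0 < s -> r0 < t ->
  Cmod (ratio s t Zs Zt r) <=
    Cmod (ratio s t Zs Zt r0) * exp (12 * M / delta * Rpower T delta).
Proof.
  intros HM Hd HL HH Hs Ht Hne HsT Hr Hs0 Ht0.
  pose (m := Rmin s t).
  assert (Hm : r0 < m) by (now apply Rmin_glb_lt).
  assert (Hms : m <= s) by apply Rmin_l. assert (Hmt : m <= t) by apply Rmin_r.
  pose (R := ratio s t Zs Zt).
  pose (dR := fun r => (- kern L s t Zs Zt r * R r)%C).
  assert (HR : forall x, r <= x <= r0 -> Cderiv R x (dR x)).
  { intros x Hx. apply Cderiv_ratio; auto; lra. }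
  pose (f := fun x => Re (R x) * Re (R x) + Im (R x) * Im (R x)).
  pose (df := fun x => 2 * (Re (R x) * Re (dR x) + Im (R x) * Im (dR x))).
  pose (g := fun x => - (12 * M / delta) * Rpower (m - x) delta).
  pose (dg := fun x => 12 * M * (Rpower (m - x) delta / (m - x))).
  assert (Hf : forall x, r <= x <= r0 -> is_derive f x (df x)).
  { intros x Hx. destruct (HR x Hx) as [H1 H2]. eapply derive_eq.
    apply derive_plus; apply derive_mult; eassumption. unfold df; cbv beta; ring. }
  assert (Hg : forall x, r <= x <= r0 -> is_derive g x (dg x)).
  { intros x Hx. eapply derive_eq.
    apply derive_mult; [apply derive_const | apply derive_Rpower_rev; lra].
    unfold dg; cbv beta. field. lra. }
  destruct (gronwall f df g dg r r0) as [_ Hgw]; [lra| | | | | |].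
  - intros; apply Hf; lra.
  - intros; eapply derive_continuous; apply Hf; lra.
  - intros; apply Hg; lra.
  - intros; eapply derive_continuous; apply Hg; lra.
  - intros x Hx. unfold df.
    pose proof (Rabs_inner_le_Cmod (R x) (dR x)) as Hin.
    rewrite Rabs_mult, (Rabs_pos_eq 2) by lra.
    unfold dR in Hin at 3. rewrite Cmod_mult, Cmod_opp in Hin.
    pose proof (kern_le M delta L s t Zs Zt (m - x) x HM Hd HL HH Hs Ht ltac:(lra) ltac:(lra) ltac:(lra) ltac:(lra)) as Hk.
    unfold f. rewrite <- Cmod_sq. unfold dg.
    assert (Cmod (kern L s t Zs Zt x) * (Cmod (R x) * Cmod (R x)) <=
       6 * M * (Rpower (m - x) delta / (m - x)) * (Cmod (R x) * Cmod (R x))).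
    { apply Rmult_le_compat_r; auto. apply Rle_0_sqr. }
    lra.
  - assert (He0 : 0 <= 12 * M / delta * Rpower T delta).
    { apply Rmult_le_pos; [|left; apply Rpower_pos]. apply Rle_mult_inv_pos; lra. }
    fold R. apply Cmod_le_of_sq; try apply Cmod_ge_0.
    + pose proof (exp_ineq1_le (12 * M / delta * Rpower T delta)). lra.
    + rewrite !Cmod_sq. eapply Rle_trans; [exact Hgw|].
      apply Rmult_le_compat_l; [unfold f; rewrite <- Cmod_sq; apply Rle_0_sqr|].
      assert (Hgg : g r0 - g r <= 12 * M / delta * Rpower T delta).
      { unfold g. pose proof (Rpower_pos (m - r0) delta).
        assert (Rpower (m - r) delta <= Rpower T delta) by (apply Rpower_le_base; lra).
        assert (0 < 12 * M / delta) by (apply Rdiv_lt_0_compat; lra). nra. }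
      destruct Hgg as [Hgg | ->]; [left; now apply exp_increasing|lra].
Qed.

(** At a time [h] before absorption, with [h] of larger order than [|t - s|], both
    trajectories still look straight and so does their gap: its straight value is of
    order [|t - s| / sqrt h], against an error of order [h^(1/2 + delta)]. *)
Lemma ratio_near_1 M delta L s t Zs Zt h r0 :
  0 < M -> 0 < delta -> sqrt_lipschitz L -> holder M delta L ->
  absorbed L s Zs -> absorbed L t Zt -> s <> t ->
  0 < r0 < s -> r0 < t -> s - r0 <= h -> t - r0 <= h ->
  Cmod (ratio s t Zs Zt r0 - 1) <= 6 * M * (h * Rpower h delta / Rabs (t - s)).
Proof.
  intros HM Hd HL HH Hs Ht Hne Hs0 Ht0 Hsh Hth.
  pose proof (absorbed_near_straight M delta L s Zs r0 HM Hd HL HH Hs ltac:(lra)) as Ds.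
  pose proof (absorbed_near_straight M delta L t Zt r0 HM Hd HL HH Ht ltac:(lra)) as Dt.
  pose proof (straight_gap_neq s t r0 (proj2 Hs0) Ht0 Hne) as Hp.
  assert (E : (ratio s t Zs Zt r0 - 1 =
     ((Zt r0 - L r0 - straight t r0) - (Zs r0 - L r0 - straight s r0)) / (straight t r0 - straight s r0))%C).
  { unfold ratio. field. exact Hp. }
  rewrite E, Cmod_div by auto.
  assert (Hnum : Cmod ((Zt r0 - L r0 - straight t r0) - (Zs r0 - L r0 - straight s r0)) <=
     6 * M * (sqrt h * Rpower h delta)).
  { eapply Rle_trans; [apply Cmod_triangle|]. rewrite Cmod_opp.
    assert (B : forall u, 0 < u <= h -> sqrt u * Rpower u delta <= sqrt h * Rpower h delta).
    { intros u Hu. apply Rmult_le_compat.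
      apply sqrt_pos. left; apply Rpower_pos. apply sqrt_le_1_alt; lra. apply Rpower_le_base; lra. }
    pose proof (B (s - r0) ltac:(lra)). pose proof (B (t - r0) ltac:(lra)). nra. }
  rewrite Cmod_straight_gap by lra.
  assert (Hst : 0 < Rabs (t - s)) by (apply Rabs_pos_lt; lra).
  assert (ps : 0 < sqrt (s - r0)) by (apply sqrt_lt_R0; lra).
  assert (pt : 0 < sqrt (t - r0)) by (apply sqrt_lt_R0; lra).
  assert (hs : sqrt (s - r0) <= sqrt h) by (apply sqrt_le_1_alt; lra).
  assert (ht : sqrt (t - r0) <= sqrt h) by (apply sqrt_le_1_alt; lra).
  assert (Hhh : sqrt h * sqrt h = h) by (apply sqrt_sqrt; lra).
  replace (6 * M * (h * Rpower h delta / Rabs (t - s)))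
    with (6 * M * (sqrt h * Rpower h delta) * (sqrt h / Rabs (t - s)))
    by (transitivity (6 * M * ((sqrt h * sqrt h) * Rpower h delta / Rabs (t - s))); [|rewrite Hhh]; field; lra).
  unfold Rdiv at 1. apply Rmult_le_compat; auto.
  - apply Cmod_ge_0.
  - left; apply Rinv_0_lt_compat. apply Rdiv_lt_0_compat; lra.
  - replace (/ (2 * Rabs (t - s) / (sqrt (t - r0) + sqrt (s - r0))))
      with ((sqrt (t - r0) + sqrt (s - r0)) / 2 * / Rabs (t - s)) by (field; lra).
    apply Rmult_le_compat_r; [left; now apply Rinv_0_lt_compat|lra].
Qed.

(** The gap is at most [K] times the straight gap, hence [O(|t - s| / sqrt u)],
    whereas the denominators are at least [u^(3/2)]. *)
Lemma kern_diff_le L s t Zs Zt K u r :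
  sqrt_lipschitz L -> absorbed L s Zs -> absorbed L t Zt -> s <> t ->
  0 < r -> 0 < u -> u <= s - r -> u <= t - r ->
  Cmod (ratio s t Zs Zt r) <= K ->
  Cmod (kern L s s Zs Zs r - kern L s t Zs Zt r) <= 2 * (K + 1) * Rabs (t - s) / (u * u).
Proof.
  intros HL Hs Ht Hne Hr Hu Hus Hut HK.
  pose proof (absorbed_Cmod_ge L s Zs r HL Hs ltac:(lra)) as Gs.
  pose proof (absorbed_Cmod_ge L t Zt r HL Ht ltac:(lra)) as Gt.
  pose proof (absorbed_neq L s Zs r Hs ltac:(lra)) as Ns.
  pose proof (absorbed_neq L t Zt r Ht ltac:(lra)) as Nt.
  pose proof (straight_neq s r ltac:(lra)) as ns.
  pose proof (straight_neq t r ltac:(lra)) as nt.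
  pose proof (Cmod_straight s r) as cs. pose proof (Cmod_straight t r) as ct.
  pose proof (straight_gap_neq s t r ltac:(lra) ltac:(lra) Hne) as Hp.
  assert (Hst : 0 < Rabs (t - s)) by (apply Rabs_pos_lt; lra).
  assert (pu : 0 < sqrt u) by (apply sqrt_lt_R0; lra).
  assert (us : sqrt u <= sqrt (s - r)) by (apply sqrt_le_1_alt; lra).
  assert (ut : sqrt u <= sqrt (t - r)) by (apply sqrt_le_1_alt; lra).
  assert (Huu : sqrt u * sqrt u = u) by (apply sqrt_sqrt; lra).
  set (P := (straight t r - straight s r)%C) in *.
  set (Rr := ratio s t Zs Zt r) in *.
  assert (HQ : (Zt r - Zs r = Rr * P)%C).
  { unfold Rr, ratio. fold P. field. exact Hp. }
  assert (E : (kern L s s Zs Zs r - kern L s t Zs Zt r =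
    2 * (Rr * P) / ((Zs r - L r) * (Zs r - L r) * (Zt r - L r)) +
    2 * (- P) / (straight s r * straight s r * straight t r))%C).
  { rewrite <- HQ. unfold P, kern. field. repeat split; auto. }
  rewrite E. clear E.
  assert (HPm : Cmod P <= Rabs (t - s) / sqrt u).
  { unfold P. rewrite Cmod_straight_gap by lra.
    replace (Rabs (t - s) / sqrt u) with (2 * Rabs (t - s) / (2 * sqrt u)) by (field; lra).
    unfold Rdiv. apply Rmult_le_compat_l; [lra|]. apply Rinv_le_contravar; lra. }
  assert (HRP : Cmod (Rr * P) <= K * (Rabs (t - s) / sqrt u)).
  { rewrite Cmod_mult. apply Rmult_le_compat; auto; apply Cmod_ge_0. }
  assert (HP' : Cmod (- P) <= Rabs (t - s) / sqrt u) by (rewrite Cmod_opp; exact HPm).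
  assert (T1 := Cmod_frac3_le _ _ _ _ _ _ _ _ pu pu pu
     (Rle_trans _ _ _ us Gs) (Rle_trans _ _ _ us Gs) (Rle_trans _ _ _ ut Gt) HRP).
  assert (T2 := Cmod_frac3_le (- P)%C (straight s r) (straight s r) (straight t r) _ _ _ _ pu pu pu
     ltac:(lra) ltac:(lra) ltac:(lra) HP').
  eapply Rle_trans; [apply Cmod_triangle|].
  replace (u * u) with ((sqrt u * sqrt u) * (sqrt u * sqrt u)) by (rewrite Huu; ring).
  replace (2 * (K + 1) * Rabs (t - s) / (sqrt u * sqrt u * (sqrt u * sqrt u))) with
    (2 * (K * (Rabs (t - s) / sqrt u)) / (sqrt u * sqrt u * sqrt u) +
     2 * (Rabs (t - s) / sqrt u) / (sqrt u * sqrt u * sqrt u)).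
  - lra.
  - field. lra.
Qed.

(** With [N] a primitive of [kern] for [s] and [s], the product [ratio * exp N] is
    almost constant on [0, r0]: by [kern_diff_le] its logarithmic derivative is
    [O(|t - s| / u^2)], which integrates to [O(|t - s| / h)].  When
    [|t - s| = h^(1 + delta/2)], this error and the one in [ratio_near_1] are both
    [O(h^(delta/2))]. *)
Lemma ratio_0_near_exp M delta T L s t Zs Zt N Nb h r0 :
  0 < M -> 0 < delta <= 1 / 2 -> sqrt_lipschitz L -> holder M delta L ->
  absorbed L s Zs -> absorbed L t Zt -> s <> t -> s <= T ->
  (forall r, r < s -> Cderiv N r (kern L s s Zs Zs r)) ->
  (forall r, 0 < r < s -> Cmod (N r) <= Nb) -> N 0 = 0 ->
  0 < h -> Rabs (t - s) = h * Rpower h (delta / 2) -> Rpower h (delta / 2) <= / 2 ->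
  r0 = Rmax s t - h -> 0 < r0 ->
  let K := (1 + 6 * M) * exp (12 * M / delta * Rpower T delta) in
  Cmod (ratio s t Zs Zt 0 - Cexp (N r0)) <=
    (4 * K * (K + 1) * exp Nb + 6 * M * exp Nb) * Rpower h (delta / 2).
Proof.
  intros HM Hd HL HH Hs Ht Hne HsT HN HNb HN0 Hh Heps Hw Hr0 Hr0pos K.
  set (w := Rpower h (delta / 2)) in *.
  assert (Hwpos : 0 < w) by apply Rpower_pos.
  pose (m := Rmin s t).
  assert (Hmm : Rmax s t - m = Rabs (t - s)).
  { unfold m, Rmax, Rmin, Rabs. destruct (Rle_dec s t), (Rcase_abs (t - s)); lra. }
  assert (Hms : m <= s) by apply Rmin_l. assert (Hmt : m <= t) by apply Rmin_r.
  assert (Hxs : s <= Rmax s t) by apply Rmax_l. assert (Hxt : t <= Rmax s t) by apply Rmax_r.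
  assert (Hhw : h * w <= h * / 2) by (apply Rmult_le_compat_l; lra).
  assert (Hmr0 : h / 2 <= m - r0) by lra.
  pose proof (ratio_near_1 M delta L s t Zs Zt h r0 HM (proj1 Hd) HL HH Hs Ht Hne
    ltac:(lra) ltac:(lra) ltac:(lra) ltac:(lra)) as Hnear.
  assert (Hww : Rpower h delta = w * w).
  { unfold w. rewrite <- Rpower_plus. f_equal. lra. }
  rewrite Heps, Hww in Hnear.
  replace (h * (w * w) / (h * w)) with w in Hnear by (field; lra).
  set (E := exp (12 * M / delta * Rpower T delta)) in *.
  assert (HE : 0 < E) by apply exp_pos.
  assert (HR0 : Cmod (ratio s t Zs Zt r0) <= 1 + 6 * M).
  { replace (ratio s t Zs Zt r0) with (1 + (ratio s t Zs Zt r0 - 1))%C by ring.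
    eapply Rle_trans; [apply Cmod_triangle|]. rewrite Cmod_1. nra. }
  assert (HK : forall r, 0 < r <= r0 -> Cmod (ratio s t Zs Zt r) <= K).
  { intros r Hr.
    pose proof (ratio_growth_le M delta T L s t Zs Zt r r0 HM Hd HL HH Hs Ht Hne HsT Hr ltac:(lra) ltac:(lra)).
    unfold K. fold E in H. eapply Rle_trans; [exact H|]. apply Rmult_le_compat_r; lra. }
  assert (HK0 : 0 <= K) by (unfold K; apply Rmult_le_pos; lra).
  pose (S := fun r => (ratio s t Zs Zt r * Cexp (N r))%C).
  pose (dS := fun r => (ratio s t Zs Zt r * Cexp (N r) * (kern L s s Zs Zs r - kern L s t Zs Zt r))%C).
  assert (HdS : forall r, 0 < r < s -> r < t -> Cderiv S r (dS r)).
  { intros r Hr Hrt. eapply Cderiv_eq.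
    - apply Cderiv_mult; [apply (Cderiv_ratio L); auto; lra | apply Cderiv_exp, HN; lra].
    - unfold dS; cbv beta; ring. }
  pose (c := K * exp Nb * (2 * (K + 1) * Rabs (t - s))).
  assert (Heps0 : 0 <= Rabs (t - s)) by apply Rabs_pos.
  assert (Hc0 : 0 <= c).
  { unfold c. repeat apply Rmult_le_pos; try lra. left; apply exp_pos. }
  assert (HSinc : Cmod (S r0 - S 0) <= c * / (m - r0) - c * / (m - 0)).
  { apply (Cmod_increment_le S dS (fun r => c * / (m - r)) (fun r => c * / ((m - r) * (m - r)))); [lra| | | | |].
    - intros x Hx. apply HdS; lra.
    - intros x Hx. apply Ccont_mult.
      + apply Ccont_mult.
        * apply Ccont_minus; [apply (absorbed_cont _ _ _ Ht) | apply (absorbed_cont _ _ _ Hs)]; lra.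
        * eapply Cderiv_cont. apply Cderiv_inv; [|apply straight_gap_neq; lra].
          apply Cderiv_minus; apply Cderiv_straight; lra.
      + eapply Cderiv_cont. apply Cderiv_exp, HN; lra.
    - intros x Hx. eapply derive_eq.
      + apply derive_mult; [apply derive_const|]. apply is_derive_inv; [|lra].
        apply derive_minus; [apply derive_const|apply derive_id].
      + cbv beta. field. lra.
    - intros x Hx. eapply derive_continuous.
      apply derive_mult; [apply derive_const|]. apply is_derive_inv; [|lra].
      apply derive_minus; [apply derive_const|apply derive_id].
    - intros x Hx. unfold dS. rewrite !Cmod_mult.
      pose proof (HK x ltac:(lra)) as HKx.
      pose proof (kern_diff_le L s t Zs Zt K (m - x) x HL Hs Ht Hne
        ltac:(lra) ltac:(lra) ltac:(lra) ltac:(lra) HKx) as Hk.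
      pose proof (Cmod_Cexp_le (N x) Nb (HNb x ltac:(lra))) as Hex.
      replace (c * / ((m - x) * (m - x))) with
        (K * exp Nb * (2 * (K + 1) * Rabs (t - s) / ((m - x) * (m - x)))) by (unfold c; field; lra).
      apply Rmult_le_compat; auto; try apply Cmod_ge_0.
      + apply Rmult_le_pos; apply Cmod_ge_0.
      + apply Rmult_le_compat; auto; apply Cmod_ge_0. }
  assert (HSle : Cmod (S r0 - S 0) <= 4 * K * (K + 1) * exp Nb * w).
  { eapply Rle_trans; [exact HSinc|].
    assert (0 <= c * / (m - 0)) by (apply Rle_mult_inv_pos; lra).
    assert (c * / (m - r0) <= c * / (h / 2)).
    { apply Rmult_le_compat_l; auto. apply Rinv_le_contravar; lra. }
    replace (c * / (h / 2)) with (4 * K * (K + 1) * exp Nb * w) in H0.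
    - lra.
    - unfold c. rewrite Heps. field. lra. }
  assert (HS0 : S 0 = ratio s t Zs Zt 0) by (unfold S; rewrite HN0, Cexp_0; ring).
  rewrite HS0 in HSle.
  replace (ratio s t Zs Zt 0 - Cexp (N r0))%C with
    (- (S r0 - ratio s t Zs Zt 0) + (ratio s t Zs Zt r0 - 1) * Cexp (N r0))%C by (unfold S; ring).
  eapply Rle_trans; [apply Cmod_triangle|]. rewrite Cmod_opp, Cmod_mult.
  pose proof (Cmod_Cexp_le (N r0) Nb (HNb r0 ltac:(lra))) as Hex.
  assert (Cmod (ratio s t Zs Zt r0 - 1) * Cmod (Cexp (N r0)) <= 6 * M * w * exp Nb).
  { apply Rmult_le_compat; auto; apply Cmod_ge_0. }
  lra.
Qed.

(** * Derivatives relative to a set *)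

Lemma norm_C_R (z : C) : norm (V := C_R_NormedModule) z = Cmod z.
Proof.
  destruct z as [x y]. unfold norm; simpl. unfold prod_norm; simpl. unfold norm; simpl.
  unfold abs; simpl. unfold Cmod; simpl. f_equal. rewrite !Rmult_1_r, <- !Rabs_mult.
  rewrite !Rabs_pos_eq by apply Rle_0_sqr. reflexivity.
Qed.

Lemma is_derive_within_iff D f x l :
  D x ->
  (is_derive_within D f x l <->
   forall eps, 0 < eps -> exists d, 0 < d /\ forall y, D y -> Rabs (y - x) < d ->
     Cmod (f y - f x - (y - x)%R * l) <= eps * Rabs (y - x)).
Proof.
  intros HD.
  assert (Hnorm : forall y, norm (V := C_R_NormedModule)
      (minus (minus (f y) (f x)) (scal (minus y x) l)) = Cmod (f y - f x - (y - x)%R * l)).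
  { intros y. rewrite norm_C_R. f_equal. apply injective_projections; simpl;
    unfold minus, plus, opp, scal, mult; simpl; unfold mult; simpl; ring. }
  split.
  - intros [_ H] eps He.
    destruct (H x (fun P HP => filter_imp _ _ (fun y Hy _ => Hy) HP) (mkposreal eps He)) as [d Hd].
    exists d. split; [apply cond_pos|]. intros y HyD Hy.
    specialize (Hd y Hy HyD). rewrite <- Hnorm. exact Hd.
  - intros H. split; [apply (is_linear_scal_l (V := C_R_NormedModule))|].
    intros x0 Hx0 eps.
    (* Since [D x], the trace of the filter has no limit other than [x]. *)
    assert (E : x0 = x).
    { apply Rminus_diag_uniq. apply Rabs_eq_0. apply Rle_antisym; [|apply Rabs_pos].
      apply Rnot_lt_le. intros Hlt.
      assert (Hloc : locally (x0 : R) (fun y : R => Rabs (y - x0) < Rabs (x0 - x))).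
      { exists (mkposreal _ Hlt). intros y Hy. exact Hy. }
      destruct (Hx0 _ Hloc) as [d Hd].
      specialize (Hd x (ball_center x d) HD). rewrite Rabs_minus_sym in Hd. lra. }
    subst x0. destruct (H eps (cond_pos eps)) as [d [Hd0 Hd]].
    exists (mkposreal d Hd0). intros y Hy HyD.
    eapply Rle_trans; [right; apply Hnorm | apply Hd; auto].
Qed.

Lemma Cderiv_of_eps f x l :
  (forall eps, 0 < eps -> exists d, 0 < d /\ forall y, Rabs (y - x) < d ->
     Cmod (f y - f x - (y - x)%R * l) <= eps * Rabs (y - x)) ->
  Cderiv f x l.
Proof.
  intros H. split; (split; [apply (is_linear_scal_l (V := R_NormedModule))|]);
    intros x0 Hx0 eps; assert (E : x = x0) by (apply is_filter_lim_locally_unique; auto);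
    subst x0; destruct (H eps (cond_pos eps)) as [d [Hd0 Hd]];
    exists (mkposreal d Hd0); intros y Hy; specialize (Hd y Hy);
    (eapply Rle_trans; [|exact Hd]).
  - eapply Rle_trans; [|apply re_le_Cmod]. right.
    unfold norm, minus, plus, opp, scal; simpl. unfold abs, mult; simpl. f_equal.
    unfold Re; simpl. ring.
  - eapply Rle_trans; [|apply Cmod_Im_ge]. right.
    unfold norm, minus, plus, opp, scal; simpl. unfold abs, mult; simpl. f_equal.
    unfold Im; simpl. ring.
Qed.

Lemma is_derive_of_eps f x l :
  (forall eps, 0 < eps -> exists d, 0 < d /\ forall y, Rabs (y - x) < d ->
     Cmod (f y - f x - (y - x)%R * l) <= eps * Rabs (y - x)) ->
  is_derive (K := R_AbsRing) (V := C_R_NormedModule) f x l.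
Proof.
  intros H.
  assert (Hw : is_derive_within (fun _ => True) f x l).
  { apply is_derive_within_iff; auto. intros eps He. destruct (H eps He) as [d [Hd0 Hd]].
    exists d. split; auto. }
  destruct Hw as [Hl Hw]. split; auto. intros x0 Hx0 eps.
  destruct (Hw x0 (fun P HP => filter_imp _ _ (fun y Hy _ => Hy) (Hx0 P HP)) eps) as [d Hd].
  exists d. intros y Hy. now apply Hd.
Qed.

(** * The Loewner flow of a point *)

Definition clamp (a b x : R) : R := Rmax a (Rmin b x).

Lemma clamp_id a b x : a <= x <= b -> clamp a b x = x.
Proof. intros H. unfold clamp. rewrite Rmin_right, Rmax_right; lra. Qed.

Lemma clamp_range a b x : a <= b -> a <= clamp a b x <= b.
Proof.
  intros H. unfold clamp, Rmax, Rmin.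
  destruct (Rle_dec b x); destruct (Rle_dec a _); lra.
Qed.

Lemma clamp_lip a b x y : a <= b -> Rabs (clamp a b x - clamp a b y) <= Rabs (x - y).
Proof.
  intros H. unfold clamp, Rmax, Rmin.
  destruct (Rle_dec b x), (Rle_dec b y);
  repeat (match goal with |- context [Rle_dec a ?z] => destruct (Rle_dec a z) end);
  unfold Rabs; repeat (match goal with |- context [Rcase_abs ?z] => destruct (Rcase_abs z) end); lra.
Qed.

(** Constant continuation preserves both moduli of continuity and makes them hold
    on the whole line. *)
Definition extend (T : R) (lam : R -> R) (r : R) : R := lam (clamp 0 T r).

Lemma extend_sqrt_lipschitz T lam :
  0 < T -> Rbar_le (lip_half_norm T lam) 1 -> sqrt_lipschitz (extend T lam).
Proof.
  intros HT Hn r r'. unfold extend.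
  pose proof (clamp_range 0 T r ltac:(lra)) as H1.
  pose proof (clamp_range 0 T r' ltac:(lra)) as H2.
  pose proof (clamp_lip 0 T r r' ltac:(lra)) as H3.
  set (a := clamp 0 T r) in *. set (b := clamp 0 T r') in *.
  apply Rle_trans with (sqrt (Rabs (a - b))); [|now apply sqrt_le_1_alt].
  destruct (Req_dec a b) as [-> | Hne].
  { unfold Rminus. rewrite !Rplus_opp_r, Rabs_R0. apply sqrt_pos. }
  assert (Hs : 0 < sqrt (Rabs (a - b))) by (apply sqrt_lt_R0, Rabs_pos_lt; lra).
  unfold lip_half_norm in Hn.
  match type of Hn with Rbar_le (Lub_Rbar ?E) _ => pose proof (Lub_Rbar_correct E) as [Hub _] end.
  assert (Hq : Rbar_le (Rabs (lam a - lam b) / sqrt (Rabs (a - b))) 1).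
  { eapply Rbar_le_trans; [|exact Hn]. apply Hub. exists a, b. tauto. }
  simpl in Hq. apply Rle_div_l in Hq; [|exact Hs]. lra.
Qed.

Lemma extend_holder T M delta lam :
  0 < T -> 0 < M -> 0 < delta ->
  (forall t1 t2, 0 <= t1 <= T -> 0 <= t2 <= T ->
      Rabs (lam t1 - lam t2) <= M * Rpower (Rabs (t1 - t2)) (1 / 2 + delta)) ->
  holder M delta (extend T lam).
Proof.
  intros HT HM Hd H r r' Hrr. unfold extend.
  pose proof (clamp_range 0 T r ltac:(lra)) as H1.
  pose proof (clamp_range 0 T r' ltac:(lra)) as H2.
  pose proof (clamp_lip 0 T r r' ltac:(lra)) as H3.
  set (a := clamp 0 T r) in *. set (b := clamp 0 T r') in *.
  assert (Hp : 0 < Rabs (r - r')) by (apply Rabs_pos_lt; lra).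
  destruct (Req_dec a b) as [-> | Hne].
  { unfold Rminus at 1. rewrite Rplus_opp_r, Rabs_R0.
    apply Rmult_le_pos; [lra|]. apply Rmult_le_pos; [apply sqrt_pos | left; apply Rpower_pos]. }
  assert (Hq : 0 < Rabs (a - b)) by (apply Rabs_pos_lt; lra).
  eapply Rle_trans; [apply (H a b H1 H2)|]. apply Rmult_le_compat_l; [lra|].
  rewrite Rpower_plus. replace (1 / 2) with (/ 2) by lra. rewrite Rpower_sqrt by auto.
  apply Rmult_le_compat; [apply sqrt_pos | left; apply Rpower_pos | now apply sqrt_le_1_alt |].
  apply Rpower_le_base; lra.
Qed.

(** Continuity on the whole line, rather than on [0,t], avoids one-sided limits; it
    holds once time is clamped to [0,t]. *)
Record flow (L : R -> R) (t : R) (G : R -> C) : Prop := {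
  flow_cont : forall r, Ccont G r;
  flow_ode : forall r, 0 < r < t -> Cderiv G r (2 / (G r - L r))%C;
  flow_neq : forall r, 0 <= r <= t -> (G r - L r)%C <> 0 }.

Lemma flow_bounded_away L t G :
  sqrt_lipschitz L -> 0 <= t -> flow L t G ->
  exists B, 0 <= B /\ forall r, 0 <= r <= t -> / (Cmod (G r - L r) * Cmod (G r - L r)) <= B.
Proof.
  intros HL Ht H.
  destruct (continuity_ab_maj (fun r => / (Cmod (G r - L r) * Cmod (G r - L r))) 0 t Ht) as [x [Hx Hxr]].
  - intros c Hc. apply continuity_pt_filterlim.
    assert (Hcc : Ccont (fun r => G r - L r)%C c).
    { apply Ccont_minus; [apply (flow_cont _ _ _ H)|].
      apply Ccont_RtoC. now apply sqrt_lipschitz_continuous. }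
    destruct Hcc as [H1 H2].
    change (continuous (fun r => / (Cmod (G r - L r) * Cmod (G r - L r))) c).
    apply (continuous_ext (fun r => / (Re (G r - L r)%C * Re (G r - L r)%C + Im (G r - L r)%C * Im (G r - L r)%C))).
    { intros r. now rewrite Cmod_sq. }
    apply continuous_Rinv_comp.
    + apply (continuous_plus (V := R_NormedModule)); apply (continuous_mult (K := R_AbsRing)); auto.
    + pose proof (norm2_pos _ (flow_neq _ _ _ H c Hc)) as Hp. simpl in Hp.
      apply Rgt_not_eq. unfold Re, Im in *; simpl in *; lra.
  - exists (/ (Cmod (G x - L x) * Cmod (G x - L x))). split; [|exact Hx].
    left. apply Rinv_0_lt_compat.
    assert (0 < Cmod (G x - L x)) by (apply Cmod_gt_0, (flow_neq _ _ _ H); auto).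
    now apply Rmult_lt_0_compat.
Qed.

Lemma Cdiv_parts (z : C) : z <> 0 ->
  (2 / z)%C = (2 * Re z / (Cmod z * Cmod z), - 2 * Im z / (Cmod z * Cmod z)).
Proof.
  intros Hz. rewrite Cmod_sq. pose proof (norm2_pos _ Hz) as Hp.
  destruct z as [x y]. unfold Re, Im in *; simpl in *.
  apply injective_projections; simpl; field; lra.
Qed.

(** [(Im G)^2] satisfies a linear differential inequality with bounded rate, so it
    cannot vanish in finite time. *)
Lemma flow_pos L t G :
  sqrt_lipschitz L -> 0 <= t -> flow L t G -> 0 < Im (G 0) ->
  forall r, 0 <= r <= t -> 0 < Im (G r).
Proof.
  intros HL Ht H H0.
  destruct (flow_bounded_away L t G HL Ht H) as [B [HB HBle]].
  assert (Hne : forall r, 0 <= r <= t -> Im (G r) <> 0).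
  { intros r Hr E.
    destruct (gronwall (fun r => Im (G r) * Im (G r))
       (fun r => 2 * Im (G r) * Im (2 / (G r - L r))%C)
       (fun r => 4 * B * r) (fun _ => 4 * B) 0 r) as [_ Hg]; [lra| | | | | |].
    - intros x Hx. destruct (flow_ode _ _ _ H x ltac:(lra)) as [_ H2].
      eapply derive_eq. apply derive_mult; exact H2. cbv beta; ring.
    - intros x Hx. destruct (flow_cont _ _ _ H x) as [_ H2].
      apply (continuous_mult (K := R_AbsRing)); auto.
    - intros x Hx. eapply derive_eq. apply derive_mult; [apply derive_const|apply derive_id].
      cbv beta; ring.
    - intros x Hx. eapply derive_continuous.
      apply derive_mult; [apply derive_const|apply derive_id].
    - intros x Hx. pose proof (flow_neq _ _ _ H x ltac:(lra)) as Hn.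
      rewrite (Cdiv_parts _ Hn).
      pose proof (HBle x ltac:(lra)) as Hb.
      set (n := Cmod (G x - L x) * Cmod (G x - L x)) in *.
      assert (Hnp : 0 < n) by (apply Rmult_lt_0_compat; now apply Cmod_gt_0).
      replace (Im (G x - L x)) with (Im (G x)) by (unfold Im; simpl; ring).
      unfold Im at 2; simpl snd.
      replace (2 * Im (G x) * (- 2 * Im (G x) / n)) with (- (4 * (Im (G x) * Im (G x)) * / n)) by (field; lra).
      rewrite Rabs_Ropp, Rabs_pos_eq.
      + pose proof (Rle_0_sqr (Im (G x))) as Hq. unfold Rsqr in Hq.
        assert (Im (G x) * Im (G x) * / n <= Im (G x) * Im (G x) * B) by (apply Rmult_le_compat_l; auto).
        lra.
      + apply Rle_mult_inv_pos; auto. pose proof (Rle_0_sqr (Im (G x))) as Hq. unfold Rsqr in Hq. lra.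
    - cbv beta in Hg. rewrite E in Hg. assert (0 < Im (G 0) * Im (G 0)) by now apply Rmult_lt_0_compat. lra. }
  intros r Hr. apply Rnot_le_lt. intros Hle.
  destruct (IVT_gen (fun x => Im (G x)) 0 r 0) as [x [Hx Hx0]].
  - intros x. apply continuity_pt_filterlim. apply (flow_cont _ _ _ H x).
  - unfold Rmin, Rmax; destruct (Rle_dec _ _); lra.
  - apply (Hne x); [|exact Hx0]. revert Hx. rewrite Rmin_left, Rmax_right by lra. lra.
Qed.

(** The difference [D] of two solutions satisfies [D' = - 2 D / (X1 X2)], with a
    bounded coefficient. *)
Lemma flow_unique L t G1 G2 :
  sqrt_lipschitz L -> 0 <= t -> flow L t G1 -> flow L t G2 -> G1 0 = G2 0 ->
  forall r, 0 <= r <= t -> G1 r = G2 r.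
Proof.
  intros HL Ht H1 H2 E0 r Hr.
  destruct (flow_bounded_away L t G1 HL Ht H1) as [B1 [HB1 HBle1]].
  destruct (flow_bounded_away L t G2 HL Ht H2) as [B2 [HB2 HBle2]].
  pose (D := fun r => (G1 r - G2 r)%C).
  pose (dD := fun r => (2 / (G1 r - L r) - 2 / (G2 r - L r))%C).
  assert (HD : forall x, 0 < x < r -> Cderiv D x (dD x)).
  { intros x Hx. apply Cderiv_minus; [apply (flow_ode _ _ _ H1) | apply (flow_ode _ _ _ H2)]; lra. }
  destruct (gronwall (fun r => Re (D r) * Re (D r) + Im (D r) * Im (D r))
     (fun r => 2 * (Re (D r) * Re (dD r) + Im (D r) * Im (dD r)))
     (fun r => 2 * (B1 + B2) * r) (fun _ => 2 * (B1 + B2)) 0 r) as [Hg _]; [lra| | | | | |].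
  - intros x Hx. destruct (HD x Hx) as [Ha Hb]. eapply derive_eq.
    apply derive_plus; apply derive_mult; eassumption. cbv beta; ring.
  - intros x Hx. destruct (Ccont_minus _ _ _ (flow_cont _ _ _ H1 x) (flow_cont _ _ _ H2 x)) as [Ha Hb].
    apply (continuous_plus (V := R_NormedModule)); apply (continuous_mult (K := R_AbsRing)); auto.
  - intros x Hx. eapply derive_eq. apply derive_mult; [apply derive_const|apply derive_id].
    cbv beta; ring.
  - intros x Hx. eapply derive_continuous. apply derive_mult; [apply derive_const|apply derive_id].
  - intros x Hx. rewrite Rabs_mult, (Rabs_pos_eq 2), <- Cmod_sq by lra.
    pose proof (Rabs_inner_le_Cmod (D x) (dD x)) as Hin.
    pose proof (flow_neq _ _ _ H1 x ltac:(lra)) as N1.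
    pose proof (flow_neq _ _ _ H2 x ltac:(lra)) as N2.
    assert (E : dD x = (- (2 * D x / ((G1 x - L x) * (G2 x - L x))))%C) by (unfold dD, D; field; auto).
    apply (f_equal Cmod) in E.
    rewrite Cmod_opp, Cmod_div, !Cmod_mult, Cmod_R, (Rabs_pos_eq 2) in E
      by (try lra; now apply Cmult_neq_0).
    rewrite E in Hin.
    pose proof (HBle1 x ltac:(lra)) as b1. pose proof (HBle2 x ltac:(lra)) as b2.
    assert (p1 : 0 < Cmod (G1 x - L x)) by now apply Cmod_gt_0.
    assert (p2 : 0 < Cmod (G2 x - L x)) by now apply Cmod_gt_0.
    set (a := Cmod (G1 x - L x)) in *. set (b := Cmod (G2 x - L x)) in *. set (d := Cmod (D x)) in *.
    assert (Hab : / (a * b) <= / 2 * (B1 + B2)).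
    { assert (0 <= (/ a - / b) * (/ a - / b)) by apply Rle_0_sqr.
      replace (/ (a * b)) with (/ a * / b) by (field; lra).
      replace (/ (a * a)) with (/ a * / a) in b1 by (field; lra).
      replace (/ (b * b)) with (/ b * / b) in b2 by (field; lra). lra. }
    replace (d * (2 * d / (a * b))) with (2 * (d * d) * / (a * b)) in Hin by (field; lra).
    assert (2 * (d * d) * / (a * b) <= 2 * (d * d) * (/ 2 * (B1 + B2))).
    { apply Rmult_le_compat_l; auto. pose proof (Rle_0_sqr d). unfold Rsqr in *; lra. }
    fold d. lra.
  - cbv beta in Hg. assert (ED : D 0 = 0) by (unfold D; rewrite E0; ring).
    rewrite ED, <- !Cmod_sq, Cmod_0 in Hg.
    assert (Hz : Cmod (D r) = 0) 
      by (rewrite !Rmult_0_l in Hg; apply Rsqr_0_uniq, Rle_antisym; [exact Hg | apply Rle_0_sqr]).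
    apply Cmod_eq_0 in Hz. unfold D in Hz.
    replace (G1 r) with (G1 r - G2 r + G2 r)%C by ring. rewrite Hz. ring.
Qed.

Lemma sol_restrict lam t s z g : s <= t -> loewner_sol lam t z g -> loewner_sol lam s z g.
Proof.
  intros Hst [H0 H]. split; [exact H0|]. intros r Hr. destruct (H r ltac:(lra)) as [H1 H2].
  split; [exact H1|]. apply is_derive_within_iff; [lra|]. intros eps He.
  assert (Hrt : 0 <= r <= t) by lra.
  destruct (proj1 (is_derive_within_iff (fun u => 0 <= u <= t) _ r _ Hrt) H2 eps He) as [d [Hd0 Hd]].
  exists d. split; auto. intros y Hy Hyr. apply Hd; [lra|exact Hyr].
Qed.

Lemma sol_flow T lam t z g :
  0 <= t <= T -> loewner_sol lam t z g ->
  flow (extend T lam) t (fun r => g (clamp 0 t r)).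
Proof.
  intros Ht [_ H].
  assert (Hlam : forall r, 0 <= r <= t -> extend T lam r = lam r).
  { intros r Hr. unfold extend. rewrite clamp_id; [reflexivity|lra]. }
  split.
  - intros r. apply Ccont_eps. intros eps He.
    pose proof (clamp_range 0 t r (proj1 Ht)) as Hc.
    destruct (H (clamp 0 t r) Hc) as [_ H2].
    set (c := clamp 0 t r) in *. set (l := (2 / (g c - lam c))%C) in *.
    destruct (proj1 (is_derive_within_iff (fun u => 0 <= u <= t) _ _ _ Hc) H2 1 Rlt_0_1) as [d [Hd0 Hd]].
    pose proof (Cmod_ge_0 l) as Hl.
    assert (He' : 0 < eps / (1 + Cmod l)) by (apply Rdiv_lt_0_compat; lra).
    exists (Rmin d (eps / (1 + Cmod l))). split; [now apply Rmin_pos|]. intros y Hy.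
    pose proof (clamp_lip 0 t y r (proj1 Ht)) as Hlip. fold c in Hlip.
    pose proof (Rmin_l d (eps / (1 + Cmod l))). pose proof (Rmin_r d (eps / (1 + Cmod l))).
    specialize (Hd (clamp 0 t y) (clamp_range 0 t y (proj1 Ht)) ltac:(lra)).
    set (q := clamp 0 t y) in *.
    replace (g q - g c)%C with ((g q - g c - (q - c)%R * l) + (q - c)%R * l)%C by ring.
    eapply Rle_lt_trans; [apply Cmod_triangle|]. rewrite Cmod_mult, Cmod_R.
    apply Rle_lt_trans with ((1 + Cmod l) * Rabs (q - c)); [lra|].
    apply Rle_lt_trans with ((1 + Cmod l) * Rabs (y - r)); [apply Rmult_le_compat_l; lra|].
    replace eps with ((1 + Cmod l) * (eps / (1 + Cmod l))) by (field; lra).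
    apply Rmult_lt_compat_l; lra.
  - intros r Hr. destruct (H r ltac:(lra)) as [_ H2].
    rewrite (clamp_id 0 t r), (Hlam r) by lra.
    apply Cderiv_of_eps. intros eps He.
    assert (Hrt : 0 <= r <= t) by lra.
  destruct (proj1 (is_derive_within_iff (fun u => 0 <= u <= t) _ r _ Hrt) H2 eps He) as [d [Hd0 Hd]].
    exists (Rmin d (Rmin r (t - r))). split; [repeat apply Rmin_pos; lra|]. intros y Hy.
    pose proof (Rmin_l d (Rmin r (t - r))). pose proof (Rmin_r d (Rmin r (t - r))).
    pose proof (Rmin_l r (t - r)). pose proof (Rmin_r r (t - r)).
    assert (Hy2 : Rabs (y - r) < Rmin r (t - r)) by lra. apply Rabs_def2 in Hy2.
    rewrite (clamp_id 0 t y), (clamp_id 0 t r) by lra. apply Hd; [|lra]. simpl; lra.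
  - intros r Hr E. rewrite (clamp_id 0 t r), (Hlam r) in E by lra.
    apply (proj1 (H r Hr)). replace (g r) with (g r - lam r + lam r)%C by ring. rewrite E. ring.
Qed.

(** By uniqueness, the choice made in [loewner_map] is forced. *)
Lemma loewner_map_sol T lam t r z g :
  sqrt_lipschitz (extend T lam) -> 0 <= r <= t -> t <= T ->
  loewner_sol lam t z g -> loewner_map lam r z = g r.
Proof.
  intros HL Hr HtT Hg.
  assert (Hgr := sol_restrict lam t r z g (proj2 Hr) Hg).
  unfold loewner_map.
  destruct (epsilon_spec (inhabits (RtoC 0)) (fun w : C => exists g : R -> C, loewner_sol lam r z g /\ g r = w)
     (ex_intro _ (g r) (ex_intro _ g (conj Hgr eq_refl)))) as [g' [Hg' E]].
  rewrite <- E.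
  pose proof (flow_unique _ r _ _ HL (proj1 Hr) (sol_flow T lam r z g' ltac:(lra) Hg')
    (sol_flow T lam r z g ltac:(lra) Hgr)) as U. cbv beta in U.
  rewrite !(clamp_id 0 r 0) in U by lra.
  specialize (U (eq_trans (proj1 Hg') (eq_sym (proj1 Hgr))) r ltac:(lra)).
  now rewrite !clamp_id in U by lra.
Qed.

(** A trajectory that keeps away from the real axis up to time [t] is Lipschitz,
    hence has a limit at [t], and the equation still holds at [t]. *)
Lemma sol_extends T lam t z Z e :
  0 < t <= T -> sqrt_lipschitz (extend T lam) ->
  (forall r, r < t -> Ccont Z r) ->
  (forall r, 0 < r < t -> Cderiv Z r (2 / (Z r - extend T lam r))%C) ->
  (forall r1, 0 <= r1 < t -> loewner_sol lam r1 z Z) ->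
  0 < e -> (forall r, 0 < r < t -> e <= Im (Z r)) ->
  exists g, loewner_sol lam t z g.
Proof.
  intros Ht HL Hc Hode Hsol He Hlow.
  assert (Hlam : forall r, 0 <= r <= t -> extend T lam r = lam r).
  { intros r Hr. unfold extend. rewrite clamp_id; [reflexivity|lra]. }
  set (L := extend T lam) in *.
  assert (Hge : forall r, 0 < r < t -> e <= Cmod (Z r - L r)).
  { intros r Hr. eapply Rle_trans; [apply Hlow; exact Hr|].
    eapply Rle_trans; [|apply Cmod_Im_ge]. eapply Rle_trans; [|apply Rle_abs].
    right. unfold Im; simpl; ring. }
  assert (Hne : forall r, 0 < r < t -> (Z r - L r)%C <> 0).
  { intros r Hr. apply Cmod_gt_0. pose proof (Hge r Hr). lra. }
  assert (Hlip : forall a b, 0 < a -> a <= b -> b < t -> Cmod (Z b - Z a) <= 2 / e * (b - a)).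
  { intros a b Ha Hab Hb.
    replace (2 / e * (b - a)) with (2 / e * b - 2 / e * a) by ring.
    apply (Cmod_increment_le Z (fun r => (2 / (Z r - L r))%C) (fun r => 2 / e * r) (fun _ => 2 / e)); auto.
    - intros x Hx. apply Hode; lra.
    - intros x Hx. apply Hc; lra.
    - intros x Hx. eapply derive_eq. apply derive_mult; [apply derive_const|apply derive_id]. cbv beta; ring.
    - intros x Hx. eapply derive_continuous. apply derive_mult; [apply derive_const|apply derive_id].
    - intros x Hx. rewrite Cmod_div, Cmod_R, Rabs_pos_eq by (try lra; apply Hne; lra).
      unfold Rdiv. apply Rmult_le_compat_l; [lra|]. apply Rinv_le_contravar; [lra|apply Hge; lra]. }
  assert (Hlim : forall p : C -> R, (forall z w, Rabs (p z - p w) <= Cmod (z - w)) ->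
     exists l, filterlim (fun r => p (Z r)) (at_left t) (locally l)).
  { intros p Hp. apply (filterlim_locally_cauchy (U := R_CompleteSpace)).
    intros eps. pose proof (cond_pos eps) as Heps.
    pose (d := eps / (2 / e)). assert (H2e : 0 < 2 / e) by (apply Rdiv_lt_0_compat; lra).
    assert (Hd : 0 < d) by (apply Rdiv_lt_0_compat; auto).
    exists (fun r => Rmax 0 (t - d) < r < t). split.
    { apply at_left_interval. apply Rmax_lub_lt; lra. }
    intros u v Hu Hv. change (Rabs (p (Z v) - p (Z u)) < eps).
    pose proof (Rmax_l 0 (t - d)). pose proof (Rmax_r 0 (t - d)).
    assert (Hdd : 2 / e * d = eps) by (unfold d; field; lra).
    eapply Rle_lt_trans; [apply Hp|].
    destruct (Rle_dec u v).
    - eapply Rle_lt_trans; [apply Hlip; lra|]. rewrite <- Hdd. apply Rmult_lt_compat_l; lra.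
    - replace (Z v - Z u)%C with (- (Z u - Z v))%C by ring. rewrite Cmod_opp.
      eapply Rle_lt_trans; [apply Hlip; lra|]. rewrite <- Hdd. apply Rmult_lt_compat_l; lra. }
  destruct (Hlim Re (fun z w => re_le_Cmod (z - w)%C)) as [a Ha].
  destruct (Hlim Im (fun z w => Cmod_Im_ge (z - w)%C)) as [b Hb].
  pose (z1 := (a, b) : C).
  pose (g := fun r => if Rlt_dec r t then Z r else z1).
  assert (gZ : forall r, r < t -> g r = Z r).
  { intros r Hr. unfold g. destruct (Rlt_dec r t); [reflexivity|lra]. }
  assert (gz1 : g t = z1) by (unfold g; destruct (Rlt_dec t t); [lra|reflexivity]).
  assert (Hb0 : e <= b).
  { apply (filterlim_le (F := at_left t) (fun _ => e) (fun r => Im (Z r)) (Finite e) (Finite b)).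
    - apply (at_left_imp t 0); [lra|]. exact Hlow.
    - apply filterlim_const.
    - exact Hb. }
  assert (gcont : forall r, r <= t -> Ccont g r).
  { intros r Hr. destruct (Rlt_dec r t) as [Hrt | Hrt].
    - apply (Ccont_ext_loc Z g r (t - r)); [lra| |now apply Hc].
      intros y Hy. apply Rabs_def2 in Hy. rewrite gZ; [reflexivity|lra].
    - assert (r = t) as -> by lra.
      exact (Ccont_glue_left Z z1 t Ha Hb). }
  exists g. split.
  { rewrite gZ by lra. apply (proj1 (Hsol 0 ltac:(lra))). }
  intros s Hs. destruct (Rlt_dec s t) as [Hst | Hst].
  - pose (r1 := (s + t) / 2).
    destruct (proj2 (Hsol r1 ltac:(unfold r1; lra)) s ltac:(unfold r1; lra)) as [H1 H2].
    rewrite gZ by auto. split; [exact H1|].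
    apply is_derive_within_iff; [lra|]. intros eps Heps.
    assert (Hsr : 0 <= s <= r1) by (unfold r1; lra).
    destruct (proj1 (is_derive_within_iff (fun u => 0 <= u <= r1) _ s _ Hsr) H2 eps Heps) as [d [Hd0 Hd]].
    exists (Rmin d (r1 - s)). split; [apply Rmin_pos; unfold r1; lra|]. intros y Hy Hys.
    pose proof (Rmin_l d (r1 - s)). pose proof (Rmin_r d (r1 - s)).
    assert (Hy2 : Rabs (y - s) < r1 - s) by lra. apply Rabs_def2 in Hy2.
    rewrite !gZ by (auto; unfold r1 in *; lra). apply Hd; [|lra]. lra.
  - assert (s = t) as -> by lra.
    assert (Nt : (g t - lam t)%C <> 0).
    { rewrite gz1. intros E. apply (f_equal Im) in E. unfold z1, Im in E; simpl in E. lra. }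
    split. { intros E. apply Nt. rewrite E. ring. }
    apply is_derive_within_iff; [lra|]. intros eps Heps.
    pose (dg := fun r => (2 / (g r - L r))%C).
    assert (Hdg : Ccont dg t).
    { apply Ccont_mult; [split; apply continuous_const|]. apply Ccont_inv.
      - apply Ccont_minus; [apply gcont; lra|]. apply Ccont_RtoC. now apply sqrt_lipschitz_continuous.
      - unfold L. rewrite Hlam by lra. exact Nt. }
    destruct (proj1 (Ccont_eps dg t) Hdg eps Heps) as [d [Hd0 Hd]].
    exists (Rmin d t). split; [apply Rmin_pos; lra|]. intros y Hy Hyt.
    pose proof (Rmin_l d t). pose proof (Rmin_r d t).
    set (l := (2 / (g t - lam t))%C).
    assert (El : l = dg t) by (unfold l, dg, L; rewrite Hlam by lra; reflexivity).
    rewrite Rabs_minus_sym in Hyt. rewrite (Rabs_minus_sym y t).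
    rewrite (Rabs_pos_eq (t - y)) in * by lra.
    pose (f := fun r => (g r - r * l)%C).
    replace (g y - g t - (y - t)%R * l)%C with (- (f t - f y))%C by (unfold f; rewrite RtoC_minus; ring).
    rewrite Cmod_opp. replace (eps * (t - y)) with (eps * t - eps * y) by ring.
    assert (Hlin : forall x, Cderiv (fun r => r * l)%C x l).
    { intros x. eapply Cderiv_eq.
      - apply Cderiv_mult; [|apply Cderiv_const].
        instantiate (1 := 1%C). split; simpl; [apply derive_id | apply derive_const].
      - cbv beta; ring. }
    apply (Cmod_increment_le f (fun r => (dg r - l)%C) (fun r => eps * r) (fun _ => eps)); [lra| | | | |].
    + intros x Hx. apply Cderiv_minus; [|apply Hlin].
      assert (Hx' : 0 < x < t) by lra.
      pose proof (Hode x Hx') as Hd'. unfold dg. rewrite (gZ x) by lra.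
      destruct Hd' as [D1 D2].
      split; [apply (is_derive_ext_loc (fun r => Re (Z r))); [|exact D1]
             | apply (is_derive_ext_loc (fun r => Im (Z r))); [|exact D2]];
      assert (Hp : 0 < t - x) by lra; exists (mkposreal _ Hp); intros v Hv;
      apply Rabs_def2 in Hv; simpl in Hv; unfold minus, plus, opp in Hv; simpl in Hv;
      rewrite gZ; try reflexivity; lra.
    + intros x Hx. apply Ccont_minus; [apply gcont; lra | eapply Cderiv_cont, Hlin].
    + intros x Hx. eapply derive_eq. apply derive_mult; [apply derive_const|apply derive_id]. cbv beta; ring.
    + intros x Hx. eapply derive_continuous. apply derive_mult; [apply derive_const|apply derive_id].
    + intros x Hx. rewrite El. left. apply Hd. rewrite Rabs_left; lra.
Qed.

(** Injectivity of [gam] puts [gam t] in the domain of every earlier time, so its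
    trajectory runs up to time [t].  As [gam t] is not in the domain of time [t], its
    height must tend to 0 there: otherwise [sol_extends] applies. *)
Lemma slit_absorbed T lam gam t :
  0 < t <= T -> sqrt_lipschitz (extend T lam) -> generates_slit T lam gam ->
  exists Z, absorbed (extend T lam) t Z /\ Z 0 = gam t /\
    forall r, 0 <= r < t -> Z r = loewner_map lam r (gam t).
Proof.
  intros Ht HL (_ & Hinj & _ & Him & Hdom).
  set (z := gam t). assert (Hz : 0 < Im z) by (apply Him; lra).
  assert (Hex : forall r1, 0 <= r1 < t -> exists g, loewner_sol lam r1 z g).
  { intros r1 Hr1. apply (Hdom r1 ltac:(lra) z). split; auto.
    intros [s [Hs E]]. assert (s = t) by (apply Hinj; auto; lra). lra. }
  (* [loewner_map] at a negative time is an arbitrary point: freeze the time at 0. *)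
  pose (Z := fun r => loewner_map lam (Rmax 0 r) z).
  assert (HZg : forall r1 g, 0 <= r1 < t -> loewner_sol lam r1 z g ->
     forall r, r <= r1 -> Z r = g (clamp 0 r1 r)).
  { intros r1 g Hr1 Hg r Hr. unfold Z.
    replace (clamp 0 r1 r) with (Rmax 0 r) by (unfold clamp; now rewrite Rmin_right).
    assert (0 <= Rmax 0 r <= r1) by (split; [apply Rmax_l | apply Rmax_lub; lra]).
    apply (loewner_map_sol T lam r1); auto; lra. }
  assert (HZ0 : Z 0 = z).
  { destruct (Hex 0 ltac:(lra)) as [g Hg]. rewrite (HZg 0 g ltac:(lra) Hg 0 ltac:(lra)).
    rewrite clamp_id by lra. apply (proj1 Hg). }
  assert (HZsol : forall r1, 0 <= r1 < t -> loewner_sol lam r1 z Z).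
  { intros r1 Hr1. destruct (Hex r1 Hr1) as [g Hg]. split; [exact HZ0|].
    intros s Hs. destruct (proj2 Hg s Hs) as [H1 H2].
    assert (HgZ : forall r, 0 <= r <= r1 -> Z r = g r).
    { intros r Hr. rewrite (HZg r1 g Hr1 Hg r) by lra. now rewrite clamp_id. }
    rewrite HgZ by auto. split; auto. apply is_derive_within_iff; auto. intros eps He.
    destruct (proj1 (is_derive_within_iff (fun u => 0 <= u <= r1) g s _ Hs) H2 eps He) as [d [Hd0 Hd]].
    exists d. split; auto. intros y Hy Hys. rewrite !HgZ by auto. now apply Hd. }
  assert (HZcont : forall r, r < t -> Ccont Z r).
  { intros r Hr. pose (r1 := (Rmax 0 r + t) / 2).
    assert (Hm : Rmax 0 r < t) by (apply Rmax_lub_lt; lra).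
    pose proof (Rmax_l 0 r). pose proof (Rmax_r 0 r).
    assert (Hr1 : 0 <= r1 < t) by (unfold r1; lra).
    destruct (Hex r1 Hr1) as [g Hg].
    apply (Ccont_ext_loc (fun r => g (clamp 0 r1 r)) Z r (r1 - r)); [unfold r1; lra| |].
    - intros y Hy. apply Rabs_def2 in Hy. symmetry. apply HZg; auto; lra.
    - apply (flow_cont _ _ _ (sol_flow T lam r1 z g ltac:(lra) Hg)). }
  assert (HZode : forall r, 0 < r < t -> Cderiv Z r (2 / (Z r - extend T lam r))%C).
  { intros r Hr. pose (r1 := (r + t) / 2). assert (Hr1 : 0 <= r1 < t) by (unfold r1; lra).
    destruct (Hex r1 Hr1) as [g Hg]. rewrite (HZg r1 g Hr1 Hg r) by (unfold r1; lra).
    destruct (flow_ode _ _ _ (sol_flow T lam r1 z g ltac:(lra) Hg) r ltac:(unfold r1; lra)) as [D1 D2].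
    cbv beta in D1, D2.
    split; [apply (is_derive_ext_loc (fun r => Re (g (clamp 0 r1 r)))); [|exact D1]
           | apply (is_derive_ext_loc (fun r => Im (g (clamp 0 r1 r)))); [|exact D2]];
    assert (Hp : 0 < r1 - r) by (unfold r1; lra); exists (mkposreal _ Hp); intros v Hv;
    change (Rabs (v - r) < r1 - r) in Hv; apply Rabs_def2 in Hv;
    (rewrite (HZg r1 g Hr1 Hg v) by lra); reflexivity. }
  assert (HZpos : forall r, r < t -> 0 < Im (Z r)).
  { intros r Hr. pose (r1 := Rmax 0 r).
    assert (Hr1 : 0 <= r1 < t) by (split; [apply Rmax_l | apply Rmax_lub_lt; lra]).
    destruct (Hex r1 Hr1) as [g Hg]. rewrite (HZg r1 g Hr1 Hg r) by apply Rmax_r.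
    pose proof (clamp_range 0 r1 r (proj1 Hr1)) as Hcr.
    assert (H0 : 0 < Im (g (clamp 0 r1 0))) by (rewrite clamp_id, (proj1 Hg) by lra; exact Hz).
    pose proof (flow_pos (extend T lam) r1 (fun r => g (clamp 0 r1 r)) HL (proj1 Hr1)
      (sol_flow T lam r1 z g ltac:(lra) Hg) H0 (clamp 0 r1 r) Hcr) as P.
    cbv beta in P. now rewrite (clamp_id 0 r1 (clamp 0 r1 r)) in P. }
  exists Z. split; [split; auto|].
  - assert (Hdec : forall a b, 0 < a -> a <= b -> b < t -> Im (Z b) <= Im (Z a)).
    { intros a b Ha Hab Hb. assert (0 - Im (Z a) <= 0 - Im (Z b)); [|lra].
      apply (le_of_derive_nonneg (fun r => 0 - Im (Z r)) (fun r => 0 - Im (2 / (Z r - extend T lam r))%C)); auto.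
      - intros x Hx. apply derive_minus; [apply derive_const | apply (HZode x); lra].
      - intros x Hx. apply (continuous_minus (V := R_NormedModule)); [apply continuous_const | apply (HZcont x); lra].
      - intros x Hx. pose proof (HZpos x ltac:(lra)) as Hp.
        assert (Hn : (Z x - extend T lam x)%C <> 0).
        { intros E. apply (f_equal Im) in E. unfold Im in *; simpl in *; lra. }
        rewrite (Cdiv_parts _ Hn). unfold Im at 1; simpl snd.
        replace (Im (Z x - extend T lam x)) with (Im (Z x)) by (unfold Im; simpl; ring).
        assert (0 <= 2 * Im (Z x) / (Cmod (Z x - extend T lam x) * Cmod (Z x - extend T lam x))).
        { apply Rle_mult_inv_pos; [lra|]. apply Rmult_lt_0_compat; now apply Cmod_gt_0. }
        unfold Rdiv, Im in *; simpl in *; lra. }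
    destruct (classic (exists e, 0 < e /\ forall r, 0 < r < t -> e <= Im (Z r))) as [[e [He Hlow]] | Hno].
    + exfalso. destruct (sol_extends T lam t z Z e Ht HL HZcont HZode HZsol He Hlow) as [g Hg].
      assert (Hd : loewner_domain lam t z) by (split; eauto).
      apply (Hdom t ltac:(lra) z) in Hd. apply (proj2 Hd). exists t. split; [lra|reflexivity].
    + apply filterlim_locally. intros eps.
      destruct (classic (exists r, 0 < r < t /\ Im (Z r) < eps)) as [[r [Hr Hlt]] | Hn2].
      * apply (at_left_imp t r); [lra|]. intros y Hy.
        change (Rabs (Im (Z y) - 0) < eps). pose proof (HZpos y ltac:(lra)).
        pose proof (Hdec r y ltac:(lra) ltac:(lra) ltac:(lra)). rewrite Rabs_pos_eq; lra.
      * exfalso. apply Hno. exists eps. split; [apply cond_pos|]. intros r Hr.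
        apply Rnot_lt_le. intros Hlt. apply Hn2. now exists r.
  - split; [exact HZ0|]. intros r Hr. unfold Z. now rewrite Rmax_right by lra.
Qed.

(** * The integral in the velocity formula *)

Lemma RInt_exists_pos (f : R -> R) a s :
  (forall u, 0 < u -> continuous f u) -> 0 < a -> 0 < s -> is_RInt f a s (RInt f a s).
Proof.
  intros Hf Ha Hs. apply (RInt_correct (V := R_CompleteNormedModule)).
  apply (ex_RInt_continuous (V := R_CompleteNormedModule)). intros z Hz. apply Hf.
  revert Hz. unfold Rmin. destruct (Rle_dec a s); lra.
Qed.

Lemma derive_RInt_left (f : R -> R) a s :
  (forall u, 0 < u -> continuous f u) -> 0 < a -> 0 < s ->
  is_derive (fun x => RInt f x s) a (- f a).
Proof.
  intros Hf Ha Hs. apply (is_derive_RInt' f _ a s).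
  - exists (mkposreal a Ha). intros x Hx. change (Rabs (x - a) < a) in Hx.
    apply Rabs_def2 in Hx. apply RInt_exists_pos; auto; lra.
  - now apply Hf.
Qed.

(** The function [c u^delta / delta] dominates the variation of the partial
    integrals, which are therefore Cauchy. *)
Lemma improper_lim (f : R -> R) (c delta s : R) :
  0 < delta -> 0 < s -> 0 <= c ->
  (forall u, 0 < u -> continuous f u) ->
  (forall u, 0 < u < s -> Rabs (f u) <= c * (Rpower u delta / u)) ->
  exists l, filterlim (fun x => RInt f x s) (at_right 0) (locally l).
Proof.
  intros Hd Hs Hc Hf Hb.
  pose (g := fun x => c / delta * Rpower x delta).
  assert (Hg : forall x, 0 < x -> is_derive g x (c * (Rpower x delta / x))).
  { intros x Hx. unfold g, Rpower. eapply derive_eq.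
    - apply derive_mult; [apply derive_const|]. apply (derive_comp exp); [apply is_derive_exp|].
      apply derive_mult; [apply derive_const|]. now apply is_derive_ln.
    - cbv beta. field. lra. }
  assert (Hmono : forall sg, sg * sg = 1 -> forall x y, 0 < x -> x <= y -> y < s ->
     sg * (RInt f x s - RInt f y s) <= g y).
  { intros sg Hsg x y Hx Hxy Hy.
    assert (g x - - sg * RInt f x s <= g y - - sg * RInt f y s).
    { apply (le_of_derive_nonneg (fun x => g x - - sg * RInt f x s)
        (fun x => c * (Rpower x delta / x) - sg * f x)); auto.
      - intros u Hu. eapply derive_eq.
        + apply derive_minus; [apply Hg; lra|]. apply derive_mult; [apply derive_const|].
          apply derive_RInt_left; auto; lra.
        + cbv beta; ring.
      - intros u Hu. eapply derive_continuous.
        apply derive_minus; [apply Hg; lra|]. apply derive_mult; [apply derive_const|].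
        apply derive_RInt_left; auto; lra.
      - intros u Hu. pose proof (Hb u ltac:(lra)) as H1.
        assert (sg * f u <= Rabs (f u)); [|lra].
        eapply Rle_trans; [apply Rle_abs|]. rewrite Rabs_mult.
        replace (Rabs sg) with 1; [lra|]. unfold Rabs. destruct (Rcase_abs sg); nra. }
    assert (0 <= g x).
    { unfold g. apply Rmult_le_pos; [apply Rle_mult_inv_pos; lra | left; apply Rpower_pos]. }
    lra. }
  apply (filterlim_locally_cauchy (U := R_CompleteSpace)). intros eps.
  assert (Hgl : filterlim g (at_right 0) (locally 0)).
  { apply lim_eq with (c / delta * 0); [|ring].
    apply (lim_mult (at_right 0)); [apply filterlim_const | now apply lim_Rpower_0]. }
  exists (fun x => 0 < x < s /\ g x < eps). split.
  - destruct (proj1 (filterlim_locally _ _) Hgl eps) as [d Hd'].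
    exists (mkposreal _ (Rmin_pos d s (cond_pos d) Hs)). intros x Hx Hx0.
    change (Rabs (x - 0) < Rmin d s) in Hx. pose proof (Rmin_l d s). pose proof (Rmin_r d s).
    split.
    + apply Rabs_def2 in Hx. lra.
    + assert (Hbx : ball (0 : R) d x) by (change (Rabs (x - 0) < d); lra).
      specialize (Hd' x Hbx Hx0). change (Rabs (g x - 0) < eps) in Hd'. apply Rabs_def2 in Hd'. lra.
  - intros x y [Hx Hgx] [Hy Hgy]. change (Rabs (RInt f y s - RInt f x s) < eps).
    destruct (Rle_dec x y) as [Hxy | Hxy].
    + pose proof (Hmono 1 ltac:(ring) x y ltac:(lra) ltac:(lra) ltac:(lra)).
      pose proof (Hmono (-1) ltac:(ring) x y ltac:(lra) ltac:(lra) ltac:(lra)).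
      apply Rabs_def1; lra.
    + pose proof (Hmono 1 ltac:(ring) y x ltac:(lra) ltac:(lra) ltac:(lra)).
      pose proof (Hmono (-1) ltac:(ring) y x ltac:(lra) ltac:(lra) ltac:(lra)).
      apply Rabs_def1; lra.
Qed.

Lemma is_RInt_gen_of_lim {V : NormedModule R_AbsRing} (f : R -> V) (J : R -> V) (s : R) (l : V) :
  (forall x, 0 < x -> is_RInt f x s (J x)) ->
  filterlim J (at_right 0) (locally l) ->
  is_RInt_gen f (at_right 0) (at_point s) l.
Proof.
  intros HJ Hl P HP.
  apply (Filter_prod _ _ _ (fun x => 0 < x /\ P (J x)) (fun y => y = s)).
  - apply filter_and; [|now apply Hl].
    exists (mkposreal 1 Rlt_0_1). intros x _ Hx. exact Hx.
  - reflexivity.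
  - intros x y [Hx HPx] ->. exists (J x). split; [now apply HJ | exact HPx].
Qed.

(** Convergence comes from [kern_le].  The partial integrals are measured from
    [u = s], that is from flow time 0, so that [N] vanishes there and tends to the
    full integral at the absorption time. *)
Lemma kern_integral M delta L s Z :
  0 < M -> 0 < delta <= 1 / 2 -> 0 < s ->
  sqrt_lipschitz L -> holder M delta L -> absorbed L s Z ->
  exists (I : C) (N : R -> C) (Nb : R),
    is_int_from_0 (fun u => kern L s s Z Z (s - u)) s I /\
    (forall r, r < s -> Cderiv N r (kern L s s Z Z r)) /\
    (forall r, 0 < r < s -> Cmod (N r) <= Nb) /\ N 0 = 0 /\
    filterlim (fun r => Re (N r)) (at_left s) (locally (Re I)) /\
    filterlim (fun r => Im (N r)) (at_left s) (locally (Im I)).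
Proof.
  intros HM Hd Hs HL HH H.
  pose (f := fun u => kern L s s Z Z (s - u)).
  assert (Hk : forall r, r < s -> Ccont (kern L s s Z Z) r).
  { intros r Hr. unfold kern.
    assert (Hc2 : Ccont (fun _ => RtoC 2) r) by (split; apply continuous_const).
    assert (HX : Ccont (fun r => Z r - L r)%C r).
    { apply Ccont_minus; [now apply (absorbed_cont _ _ _ H)|].
      apply Ccont_RtoC. now apply sqrt_lipschitz_continuous. }
    assert (Hst : Ccont (straight s) r) by (eapply Cderiv_cont; now apply Cderiv_straight).
    pose proof (absorbed_neq L s Z r H Hr). pose proof (straight_neq s r Hr).
    apply Ccont_minus; apply Ccont_mult; auto; apply Ccont_inv; auto;
      try (apply Ccont_mult; auto); now apply Cmult_neq_0. }
  assert (Hf : forall u, 0 < u -> Ccont f u).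
  { intros u Hu. destruct (Hk (s - u) ltac:(lra)) as [H1 H2].
    assert (Hc : continuous (fun u => s - u) u).
    { eapply derive_continuous. apply derive_minus; [apply derive_const|apply derive_id]. }
    split.
    - exact (continuous_comp (fun u => s - u) (fun r => Re (kern L s s Z Z r)) u Hc H1).
    - exact (continuous_comp (fun u => s - u) (fun r => Im (kern L s s Z Z r)) u Hc H2). }
  assert (Hfb : forall u, 0 < u < s -> Cmod (f u) <= 6 * M * (Rpower u delta / u)).
  { intros u Hu. unfold f. apply (kern_le M delta L s s Z Z u (s - u)); auto; lra. }
  assert (H6 : 0 <= 6 * M) by lra.
  assert (HfRe : forall u, 0 < u -> continuous (fun u => Re (f u)) u)
    by (intros u Hu; exact (proj1 (Hf u Hu))).
  assert (HfIm : forall u, 0 < u -> continuous (fun u => Im (f u)) u)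
    by (intros u Hu; exact (proj2 (Hf u Hu))).
  assert (HfM : forall u, 0 < u -> continuous (fun u => Cmod (f u)) u)
    by (intros u Hu; exact (Ccont_Cmod f u (Hf u Hu))).
  destruct (improper_lim (fun u => Re (f u)) (6 * M) delta s (proj1 Hd) Hs H6 HfRe) as [l1 Hl1].
  { intros u Hu. eapply Rle_trans; [apply re_le_Cmod | now apply Hfb]. }
  destruct (improper_lim (fun u => Im (f u)) (6 * M) delta s (proj1 Hd) Hs H6 HfIm) as [l2 Hl2].
  { intros u Hu. eapply Rle_trans; [apply Cmod_Im_ge | now apply Hfb]. }
  destruct (improper_lim (fun u => Cmod (f u)) (6 * M) delta s (proj1 Hd) Hs H6 HfM) as [l3 Hl3].
  { intros u Hu. rewrite Rabs_pos_eq by apply Cmod_ge_0. now apply Hfb. }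
  pose (J := fun x => (RInt (fun u => Re (f u)) x s, RInt (fun u => Im (f u)) x s) : C).
  pose (N := fun r => J (s - r)).
  assert (HN : forall r, r < s -> Cderiv N r (kern L s s Z Z r)).
  { intros r Hr. assert (Hp : 0 < s - r) by lra.
    assert (Hc : is_derive (fun r => s - r) r (0 - 1)).
    { apply derive_minus; [apply derive_const|apply derive_id]. }
    assert (E : kern L s s Z Z r = f (s - r)) by (unfold f; f_equal; ring). rewrite E.
    split; eapply derive_eq.
    - exact (derive_comp (fun x => RInt (fun u => Re (f u)) x s) _ r _ _
        (derive_RInt_left _ (s - r) s HfRe Hp Hs) Hc).
    - cbv beta; ring.
    - exact (derive_comp (fun x => RInt (fun u => Im (f u)) x s) _ r _ _
        (derive_RInt_left _ (s - r) s HfIm Hp Hs) Hc).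
    - cbv beta; ring. }
  assert (HN0 : N 0 = 0).
  { unfold N, J. rewrite Rminus_0_r, !(RInt_point (V := R_CompleteNormedModule)). reflexivity. }
  exists (l1, l2), N, (6 * M / delta * Rpower s delta).
  split; [split|]; [| |split; [|split; [|split; [|split]]]].
  - apply (is_RInt_gen_of_lim (V := C_R_NormedModule) f J).
    + intros x Hx. apply (is_RInt_fct_extend_pair (U := R_NormedModule) (V := R_NormedModule));
        now apply RInt_exists_pos.
    + intros P [eps HP]. unfold filtermap.
      pose proof (proj1 (filterlim_locally _ _) Hl1 eps) as E1.
      pose proof (proj1 (filterlim_locally _ _) Hl2 eps) as E2.
      generalize (filter_and _ _ E1 E2). apply filter_imp. intros x [H1 H2]. apply HP. split; assumption.
  - exists l3. apply (is_RInt_gen_of_lim (V := R_NormedModule) (fun u => Cmod (f u)) (fun x => RInt (fun u => Cmod (f u)) x s)); auto.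
    intros x Hx. now apply RInt_exists_pos.
  - exact HN.
  - intros r Hr.
    pose (g := fun r => - (6 * M / delta) * Rpower (s - r) delta).
    assert (Hg : forall x, x < s -> is_derive g x (6 * M * (Rpower (s - x) delta / (s - x)))).
    { intros x Hx. eapply derive_eq.
      apply derive_mult; [apply derive_const | apply derive_Rpower_rev; lra].
      cbv beta. field. lra. }
    replace (N r) with (N r - N 0)%C by (rewrite HN0; ring).
    apply Rle_trans with (g r - g 0).
    + apply (Cmod_increment_le N (kern L s s Z Z) g (fun x => 6 * M * (Rpower (s - x) delta / (s - x)))); [lra| | | | |].
      * intros; apply HN; lra.
      * intros; eapply Cderiv_cont, HN; lra.
      * intros; apply Hg; lra.
      * intros; eapply derive_continuous, Hg; lra.
      * intros x Hx. apply (kern_le M delta L s s Z Z (s - x) x); auto; lra.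
    + unfold g. rewrite Rminus_0_r. assert (0 < 6 * M / delta) by (apply Rdiv_lt_0_compat; lra).
      pose proof (Rpower_pos (s - r) delta). nra.
  - exact HN0.
  - apply (filterlim_comp _ _ _ (fun r => s - r) (fun x => RInt (fun u => Re (f u)) x s) _ (at_right 0)); auto.
    apply at_left_rev.
  - apply (filterlim_comp _ _ _ (fun r => s - r) (fun x => RInt (fun u => Im (f u)) x s) _ (at_right 0)); auto.
    apply at_left_rev.
Qed.

(** The integrand of the velocity formula is [kern] on the diagonal, because
    [(straight s (s - u))^2 = - 4 u]. *)
Lemma slit_velocity_of_kern T lam gam L s Z I :
  0 < s <= T -> L = extend T lam -> absorbed L s Z ->
  (forall r, 0 <= r < s -> Z r = loewner_map lam r (gam s)) ->
  is_int_from_0 (fun u => kern L s s Z Z (s - u)) s I ->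
  slit_velocity lam gam s (Ci / sqrt s * Cexp I)%C.
Proof.
  intros Hs HL HZ HZmap HI.
  exists I. split; [|reflexivity].
  assert (HLlam : forall r, 0 <= r <= T -> L r = lam r).
  { intros r Hr. rewrite HL. unfold extend. rewrite clamp_id; [reflexivity|lra]. }
  assert (Hext : forall u, 0 < u <= s ->
    kern L s s Z Z (s - u) = (1 / (2 * u) + 2 / (slit2 lam gam (s - u) s) ^ 2)%C).
  { intros u Hu. assert (Hr : 0 <= s - u < s) by lra.
    unfold kern, slit2. rewrite <- HZmap by exact Hr.
    rewrite HLlam by lra.
    rewrite straight_sq by lra. replace (s - (s - u)) with u by ring.
    assert (Hne : (Z (s - u)%R - lam (s - u)%R)%C <> 0).
    { rewrite <- HLlam by lra. apply (absorbed_neq L s Z); auto; lra. }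
    assert (Hu' : RtoC u <> 0) by (intros E; apply RtoC_inj in E; lra).
    rewrite RtoC_mult. replace (RtoC 4) with (2 * 2)%C by (rewrite <- RtoC_mult; f_equal; ring).
    assert (RtoC 2 <> 0) by (intros E; apply RtoC_inj in E; lra).
    simpl. field. repeat split; auto. }
  assert (Hev : filter_prod (at_right 0) (at_point s) (fun ab : R * R =>
     forall x, Rmin (fst ab) (snd ab) < x < Rmax (fst ab) (snd ab) -> 0 < x <= s)).
  { apply (Filter_prod _ _ _ (fun x => 0 < x < s) (fun y => y = s)).
    - exists (mkposreal s (proj1 Hs)). intros x Hx Hx0. change (Rabs (x - 0) < s) in Hx.
      apply Rabs_def2 in Hx. lra.
    - reflexivity.
    - intros a b Ha -> x Hx. simpl in Hx. rewrite Rmin_left, Rmax_right in Hx by lra. lra. }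
  destruct HI as [HI1 [l HI2]]. split.
  - eapply is_RInt_gen_ext; [|exact HI1]. generalize Hev. apply filter_imp.
    intros ab Hab x Hx. apply Hext, Hab, Hx.
  - exists l. eapply is_RInt_gen_ext; [|exact HI2]. generalize Hev. apply filter_imp.
    intros ab Hab x Hx. cbv beta. rewrite Hext; [reflexivity|]. apply Hab, Hx.
Qed.

(** * Differentiability of the slit *)

Lemma Cexp_lim_left (N : R -> C) (I : C) s eps :
  filterlim (fun r => Re (N r)) (at_left s) (locally (Re I)) ->
  filterlim (fun r => Im (N r)) (at_left s) (locally (Im I)) ->
  0 < eps ->
  exists d, 0 < d /\ forall r, s - d < r < s -> Cmod (Cexp (N r) - Cexp I) < eps.
Proof.
  intros H1 H2 He.
  pose (N' := fun r => if Rlt_dec r s then N r else I).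
  assert (Ns : N' s = I) by (unfold N'; destruct (Rlt_dec s s); [lra | reflexivity]).
  pose proof (Ccont_glue_left N I s H1 H2) as HN'. fold N' in HN'.
  destruct (proj1 (Ccont_eps _ _) (Ccont_Cexp _ _ HN') eps He) as [d [Hd0 Hd]].
  exists d. split; auto. intros r Hr. specialize (Hd r ltac:(rewrite Rabs_left; lra)).
  rewrite Ns in Hd. unfold N' in Hd. destruct (Rlt_dec r s); [exact Hd | lra].
Qed.

(** The difference quotient of [gam] is [ratio] at time 0 times
    [2 i / (sqrt t + sqrt s)], and [ratio_0_near_exp] gives the limit of the first
    factor.  Stated as an epsilon-delta bound over (0,T], which covers both the
    interior points and the end point [T]. *)
Lemma slit_derivative T M delta lam gam s :
  0 < M -> 0 < delta <= 1 / 2 -> 0 < s <= T ->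
  sqrt_lipschitz (extend T lam) -> holder M delta (extend T lam) ->
  generates_slit T lam gam ->
  exists v, slit_velocity lam gam s v /\
    forall eps, 0 < eps -> exists d, 0 < d /\ forall t, 0 < t <= T -> Rabs (t - s) < d ->
      Cmod (gam t - gam s - (t - s)%R * v) <= eps * Rabs (t - s).
Proof.
  intros HM Hd Hs HL HH Hgam. set (L := extend T lam) in *.
  destruct (slit_absorbed T lam gam s Hs HL Hgam) as [Z [HZ [HZ0 HZmap]]]. fold L in HZ.
  destruct (kern_integral M delta L s Z HM Hd (proj1 Hs) HL HH HZ)
    as (I & N & Nb & HI & HN & HNb & HN0 & HN1 & HN2).
  assert (Hss : 0 < sqrt s) by (apply sqrt_lt_R0; lra).
  exists (Ci / sqrt s * Cexp I)%C. split.
  { exact (slit_velocity_of_kern T lam gam L s Z I Hs eq_refl HZ HZmap HI). }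
  intros eps Heps.
  pose (K := (1 + 6 * M) * exp (12 * M / delta * Rpower T delta)).
  pose (C0 := 4 * K * (K + 1) * exp Nb + 6 * M * exp Nb).
  assert (HC0 : 0 <= C0).
  { assert (0 <= K) by (unfold K; apply Rmult_le_pos; [lra | left; apply exp_pos]).
    pose proof (exp_pos Nb). unfold C0. clearbody K.
    apply Rplus_le_le_0_compat; repeat apply Rmult_le_pos; lra. }
  (* The error [e1] on the ratio is multiplied by at most [2 / sqrt s]. *)
  pose (e1 := eps * sqrt s / 4).
  assert (He1 : 0 < e1).
  { unfold e1. apply Rdiv_lt_0_compat; [now apply Rmult_lt_0_compat|lra]. }
  destruct (Cexp_lim_left N I s (e1 / 2) HN1 HN2 ltac:(lra)) as [d1 [Hd1 HE]].
  assert (Hq : 0 < 1 + delta / 2) by lra.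
  assert (Hqi : 0 < / (1 + delta / 2)) by now apply Rinv_0_lt_compat.
  destruct (small_Rpower (/ (1 + delta / 2)) (Rmin (d1 / 2) (s / 2)) Hqi) as [da [Hda Ha]].
  { apply Rmin_pos; lra. }
  destruct (small_Rpower (/ (1 + delta / 2) * (delta / 2)) (Rmin (/ 2) (e1 / (2 * (C0 + 1))))) as [db [Hdb Hb]].
  { apply Rmult_lt_0_compat; lra. }
  { apply Rmin_pos; [lra|]. apply Rdiv_lt_0_compat; lra. }
  assert (HcI : 0 <= Cmod (Cexp I)) by apply Cmod_ge_0.
  assert (Hcont : exists dc, 0 < dc /\ forall t, 0 < t -> Rabs (t - s) < dc ->
     Cmod (Cexp I) * Rabs (2 / (sqrt t + sqrt s) - / sqrt s) <= eps / 2).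
  { assert (Hcc : continuous (fun t => Cmod (Cexp I) * Rabs (2 / (sqrt t + sqrt s) - / sqrt s)) s).
    { apply (continuous_mult (K := R_AbsRing)); [apply continuous_const|].
      apply (continuous_comp (fun t => 2 / (sqrt t + sqrt s) - / sqrt s) Rabs); [|apply continuous_Rabs].
      apply (continuous_minus (V := R_NormedModule)); [|apply continuous_const].
      apply (continuous_mult (K := R_AbsRing)); [apply continuous_const|].
      apply continuous_Rinv_comp; [|lra].
      apply (continuous_plus (V := R_NormedModule)); [apply continuous_sqrt | apply continuous_const]. }
    assert (He2 : 0 < eps / 2) by lra.
    destruct (proj1 (filterlim_locally _ _) Hcc (mkposreal _ He2)) as [dc Hdc].
    exists dc. split; [apply cond_pos|]. intros t Ht Hts. specialize (Hdc t Hts).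
    replace (2 / (sqrt s + sqrt s) - / sqrt s) with 0 in Hdc by (field; lra).
    rewrite Rabs_R0, Rmult_0_r in Hdc.
    change (Rabs (Cmod (Cexp I) * Rabs (2 / (sqrt t + sqrt s) - / sqrt s) - 0) < eps / 2) in Hdc.
    apply Rabs_def2 in Hdc. lra. }
  destruct Hcont as [dc [Hdc Hc]].
  exists (Rmin da (Rmin db dc)). split; [repeat apply Rmin_pos; auto|].
  intros t Ht Hts.
  destruct (Req_dec s t) as [<- | Hne].
  { replace (gam s - gam s - (s - s)%R * (Ci / sqrt s * Cexp I))%C with (RtoC 0)
      by (rewrite Rminus_diag; ring).
    rewrite Cmod_0. apply Rmult_le_pos; [lra | apply Rabs_pos]. }
  assert (Hst : 0 < Rabs (t - s)) by (apply Rabs_pos_lt; lra).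
  pose proof (Rmin_l da (Rmin db dc)). pose proof (Rmin_r da (Rmin db dc)).
  pose proof (Rmin_l db dc). pose proof (Rmin_r db dc).
  destruct (slit_absorbed T lam gam t Ht HL Hgam) as [Zt [HZt [HZt0 _]]]. fold L in HZt.
  set (e := Rabs (t - s)) in *.
  (* This [h] solves [e = h * h^(delta/2)], the balance required by
     [ratio_0_near_exp]. *)
  pose (h := Rpower e (/ (1 + delta / 2))).
  assert (Hh : 0 < h) by apply Rpower_pos.
  assert (Hha : h < Rmin (d1 / 2) (s / 2)) by (apply Ha; lra).
  pose proof (Rmin_l (d1 / 2) (s / 2)). pose proof (Rmin_r (d1 / 2) (s / 2)).
  assert (Hhe : e = h * Rpower h (delta / 2)).
  { rewrite <- (Rpower_1 h) at 1 by auto. rewrite <- Rpower_plus. unfold h.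
    rewrite Rpower_mult, Rinv_l by lra. now rewrite Rpower_1. }
  assert (Hw : Rpower h (delta / 2) < Rmin (/ 2) (e1 / (2 * (C0 + 1)))).
  { unfold h. rewrite Rpower_mult. apply Hb; lra. }
  pose proof (Rmin_l (/ 2) (e1 / (2 * (C0 + 1)))). pose proof (Rmin_r (/ 2) (e1 / (2 * (C0 + 1)))).
  assert (Heh : e <= h / 2).
  { rewrite Hhe. unfold Rdiv at 2. apply Rmult_le_compat_l; lra. }
  assert (Hmax : s <= Rmax s t /\ Rmax s t <= s + e).
  { split; [apply Rmax_l|]. apply Rmax_lub; [lra|]. unfold e. pose proof (Rle_abs (t - s)). lra. }
  pose (r0 := Rmax s t - h).
  assert (Hr0 : 0 < r0) by (unfold r0; lra).
  pose proof (ratio_0_near_exp M delta T L s t Z Zt N Nb h r0 HM Hd HL HH HZ HZt Hne (proj2 Hs)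
    HN HNb HN0 Hh Hhe ltac:(lra) eq_refl Hr0) as Hmain.
  cbv zeta in Hmain. fold K in Hmain. fold C0 in Hmain.
  assert (Hr0s : s - d1 < r0 < s) by (unfold r0; lra).
  pose proof (HE r0 Hr0s) as HEr.
  assert (HR : Cmod (ratio s t Z Zt 0 - Cexp I) <= e1).
  { replace (ratio s t Z Zt 0 - Cexp I)%C with
      ((ratio s t Z Zt 0 - Cexp (N r0)) + (Cexp (N r0) - Cexp I))%C by ring.
    eapply Rle_trans; [apply Cmod_triangle|].
    assert (C0 * Rpower h (delta / 2) <= C0 * (e1 / (2 * (C0 + 1)))) by (apply Rmult_le_compat_l; lra).
    assert (C0 * (e1 / (2 * (C0 + 1))) <= e1 / 2).
    { replace (e1 / 2) with ((C0 + 1) * (e1 / (2 * (C0 + 1)))) by (field; lra).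
      apply Rmult_le_compat_r; [|lra]. left; apply Rdiv_lt_0_compat; lra. }
    lra. }
  assert (Hgap : (gam t - gam s = ratio s t Z Zt 0 * (straight t 0 - straight s 0))%C).
  { rewrite <- HZ0, <- HZt0. unfold ratio. field. apply straight_gap_neq; lra. }
  set (Q := ratio s t Z Zt 0) in *. set (A := 2 / (sqrt t + sqrt s)).
  assert (HA : 0 <= A <= 2 / sqrt s).
  { pose proof (sqrt_lt_R0 t (proj1 Ht)). unfold A. split.
    - left. apply Rdiv_lt_0_compat; lra.
    - unfold Rdiv. apply Rmult_le_compat_l; [lra|]. apply Rinv_le_contravar; lra. }
  replace (gam t - gam s - (t - s)%R * (Ci / sqrt s * Cexp I))%C with
    (RtoC (t - s) * (Ci * ((Q - Cexp I) * RtoC A + Cexp I * RtoC (A - / sqrt s))))%C.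
  2:{ rewrite Hgap, straight_gap_0 by lra. fold A. unfold Cdiv.
      rewrite (RtoC_minus A), RtoC_inv by lra. ring. }
  rewrite !Cmod_mult, Cmod_Ci, Rmult_1_l, Cmod_R. fold e. rewrite Rmult_comm.
  apply Rmult_le_compat_r; [lra|].
  eapply Rle_trans; [apply Cmod_triangle|]. rewrite !Cmod_mult, !Cmod_R, (Rabs_pos_eq A) by lra.
  pose proof (Hc t (proj1 Ht) ltac:(fold e; lra)) as Hc2. fold A in Hc2.
  assert (HQA : Cmod (Q - Cexp I) * A <= e1 * (2 / sqrt s)).
  { apply Rmult_le_compat; try lra. apply Cmod_ge_0. }
  replace (e1 * (2 / sqrt s)) with (eps / 2) in HQA by (unfold e1; field; lra).
  lra.
Qed.

Theorem corollary4p3 (T M delta : R) (lam : R -> R) (gam : R -> C)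
    (hT : 0 < T) (hM : 0 < M) (hdelta : 0 < delta <= 1 / 2)
    (hnorm : Rbar_le (lip_half_norm T lam) 1)
    (hlam : forall t1 t2 : R, 0 <= t1 <= T -> 0 <= t2 <= T ->
      Rabs (lam t1 - lam t2) <= M * Rpower (Rabs (t1 - t2)) (1 / 2 + delta))
    (hgam : generates_slit T lam gam) :
  (forall s : R, 0 < s < T ->
    exists v : C, slit_velocity lam gam s v /\
      is_derive (K := R_AbsRing) (V := C_R_NormedModule) gam s v) /\
  (exists v : C, slit_velocity lam gam T v /\
    is_derive_within (fun u => u <= T) gam T v).
Proof.
  pose proof (extend_sqrt_lipschitz T lam hT hnorm) as HL.
  pose proof (extend_holder T M delta lam hT hM (proj1 hdelta) hlam) as HH.
  split.
  - intros s Hs.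
    destruct (slit_derivative T M delta lam gam s hM hdelta ltac:(lra) HL HH hgam) as [v [Hv Hlim]].
    exists v. split; [exact Hv|]. apply is_derive_of_eps. intros eps He.
    destruct (Hlim eps He) as [d [Hd0 Hd]].
    exists (Rmin d (Rmin s (T - s))). split; [repeat apply Rmin_pos; lra|]. intros y Hy.
    pose proof (Rmin_l d (Rmin s (T - s))). pose proof (Rmin_r d (Rmin s (T - s))).
    pose proof (Rmin_l s (T - s)). pose proof (Rmin_r s (T - s)).
    assert (Hy2 : Rabs (y - s) < Rmin s (T - s)) by lra. apply Rabs_def2 in Hy2.
    apply Hd; lra.
  - destruct (slit_derivative T M delta lam gam T hM hdelta ltac:(lra) HL HH hgam) as [v [Hv Hlim]].
    exists v. split; [exact Hv|]. apply is_derive_within_iff; [lra|]. intros eps He.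
    destruct (Hlim eps He) as [d [Hd0 Hd]].
    exists (Rmin d T). split; [apply Rmin_pos; lra|]. intros y HyT Hy.
    pose proof (Rmin_l d T). pose proof (Rmin_r d T).
    assert (Hy2 : Rabs (y - T) < T) by lra. apply Rabs_def2 in Hy2.
    apply Hd; lra.
Qed.
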